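(* Let $r\in\{1,4\}$ and let $n$ be a positive integer such that $d=n^2+r$ is square-free and $d\equiv 5\pmod 8$. Let $p$ be an odd prime divisor of $n$, and assume that $n\neq p$ if $r=4$, and that $n\neq 2p$ if $r=1$. Then $h(d)=2$ if and only if $$\sum_{\substack{ |t|<\sqrt{d}\\ t^2\equiv d \pmod 4}}\sigma\left(\frac{d-t^2}{4}\right)=\begin{cases} \dfrac{n^3+11n}{6}+ \dfrac{n^3+n(p^4+10p^2)}{6p^2}, & \text{if } r=4,\\[2mm] \dfrac{n^3+14n}{6}+\dfrac{n^3+n(4p^4+10p^2)}{6p^2}, & \text{if } r=1. \end{cases}$$
   Context: $h(d)$ denotes the class number of the real quadratic field $\mathbb{Q}(\sqrt{d})$. For a positive integer $m$, $\sigma(m)$ denotes the sum of the positive divisors of $m$. The sum runs over all integers $t$ (positive, negative or zero) satisfying the stated conditions. *)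

(* Defs.v *)
From mathcomp Require Export all_boot all_order all_algebra all_field finmap.
From mathcomp Require Export boolp classical_sets functions cardinality fsbigop.

Set Implicit Arguments.
Unset Strict Implicit.
Unset Printing Implicit Defensive.

Import Order.TTheory GRing.Theory Num.Theory.

Local Open Scope classical_set_scope.
Local Open Scope ring_scope.

Definition squarefree (m : nat) : Prop :=
  forall k : nat, (k ^ 2 %| m)%N -> k = 1%N.

Definition sigma (m : nat) : nat := (\sum_(k <- divisors m) k)%N.

(* Number fields are regarded as subfields of algC. *)
Definition quadratic_field (d : nat) : set algC :=
  [set x | exists a b : rat, x = ratr a + ratr b * sqrtC d%:R].

Definition ring_of_integers (K : set algC) : set algC :=
  [set x | K x /\ x \in Aint].

Definition is_ideal (O I : set algC) : Prop :=
  [/\ I `<=` O, I 0,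
      forall x y, I x -> I y -> I (x + y)
    & forall a x, O a -> I x -> I (a * x)].

Definition nonzero_ideal (O : set algC) : set (set algC) :=
  [set I | is_ideal O I /\ exists2 x, I x & x != 0].

(* (a) I = (b) J for some nonzero a, b in O *)
Definition ideal_equiv (O I J : set algC) : Prop :=
  exists a b : algC, [/\ O a /\ a != 0, O b /\ b != 0
    & [set a * x | x in I] = [set b * y | y in J]].

Definition ideal_class (O I : set algC) : set (set algC) :=
  [set J | nonzero_ideal O J /\ ideal_equiv O I J].

Definition ideal_classes (K : set algC) : set (set (set algC)) :=
  [set ideal_class (ring_of_integers K) I
     | I in nonzero_ideal (ring_of_integers K)].

(* fset_set is empty on infinite sets, so a positive value of class_number
   is the genuine cardinality. *)
Definition class_number (K : set algC) : nat :=
  #|` fset_set (ideal_classes K)|%fset.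

Definition h (d : nat) : nat := class_number (quadratic_field d).

(* Main.v *)
Require Import Defs.
From mathcomp Require Import zify ring.
Import Order.TTheory GRing.Theory Num.Theory.
Local Open Scope classical_set_scope.
Local Open Scope ring_scope.

(* Expanding sigma as a sum over divisors, the left-hand side becomes the sum of
   a over all indefinite forms a x^2 + b x y - c y^2 of discriminant
   d = b^2 + 4 a c with a, c > 0 (Zagier's simple forms). Such a form determines
   the ideal Z a + Z (b + sqrt d)/2, every ideal class contains one, and two of
   them have equivalent ideals exactly when they are related by the walk along
   the Conway river and by the swap (a, b, c) -> (c, -b, a). For d = n^2 + 1 or
   n^2 + 4, every factorisation of n (of n/2 if r = 1) into p and m yields one
   explicit closed walk. Its total weight is the p-summand of the right-hand
   side, and the factorisation with p = 1, the principal class, yields the other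
   summand. The hypothesis n <> p (n <> 2p) makes the two walks distinct. Since
   all weights are positive, the sum equals the right-hand side if and only if
   the two walks exhaust the simple forms, i.e. if and only if h(d) = 2. *)

Set Implicit Arguments.
Unset Strict Implicit.
Unset Printing Implicit Defensive.

(** * Simple forms and the river *)

(* (a, b, c) stands for a x^2 + b x y - c y^2; note the sign of c. *)
Definition form := (int * int * int)%type.

Definition simple (d : int) (x : form) : bool :=
  let: (a, b, c) := x in [&& 0 < a, 0 < c & b ^+ 2 + 4 * a * c == d].

Definition value (x : form) (u v : int) : int :=
  let: (a, b, c) := x in a * u ^+ 2 + b * u * v - c * v ^+ 2.

Definition act (x : form) (p q r t : int) : form :=
  let: (a, b, c) := x in
  (value x p q, 2 * a * p * r + b * (p * t + q * r) - 2 * c * q * t,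
   - value x r t).

(* The river separates the values > 0 from the values < 0; the sign of the value
   a + b - c at (1, 1) decides which of the two basis vectors is replaced. *)
Definition step (x : form) : form :=
  let: (a, b, c) := x in
  if 0 < a + b - c then (a + b - c, b - 2 * c, c) else (a, b + 2 * a, c - a - b).

Definition swap (x : form) : form := let: (a, b, c) := x in (c, - b, a).

(** [swap] sends f(x, y) to - f(y, x), so it negates the value at (1, 1) and exchanges the two
    branches of [step]. That value is nonzero, since c = a + b would give d = (b + 2 a)^2. *)
Lemma step_swap (d : int) x : (forall k : int, k ^+ 2 != d) -> simple d x ->
  step (swap x) = swap (step x).
Proof.
move=> nsq; case: x => [[a b] c] /= /and3P[a0 c0 /eqP E].
have nz : a + b - c != 0.
  apply/eqP => F; move: (nsq (b + 2 * a)); rewrite -E; have -> : c = a + b by lia.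
  by apply/negP/negPn/eqP; ring.
have [h|h] := boolP (0 < a + b - c).
  have -> : (0 < c - b - a) = false by lia.
  by rewrite /=; congr (_, _, _); lia.
have -> : (0 < c - b - a) = true by lia.
by rewrite /=; congr (_, _, _); lia.
Qed.

Lemma swapK : involutive swap.
Proof. by case=> [[a b] c] /=; rewrite opprK. Qed.

Lemma simple_swap d x : simple d (swap x) = simple d x.
Proof.
case: x => [[a b] c] /=; rewrite sqrrN.
by rewrite andbCA; congr [&& _, _ & _ == _]; ring.
Qed.

Lemma simple_step (d : int) x : (forall k : int, k ^+ 2 != d) -> simple d x -> simple d (step x).
Proof.
move=> nsq; case: x => [[a b] c] /= /and3P[a0 c0 /eqP E].
have nz : a + b - c != 0.
  apply/eqP => F; move: (nsq (b + 2 * a)); rewrite -E; have -> : c = a + b by lia.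
  by apply/negP/negPn/eqP; ring.
have [h|h] := boolP (0 < a + b - c); rewrite /=; apply/and3P; split=> //;
  try lia; apply/eqP; rewrite -E; ring.
Qed.

(** The value of the image at (1, -1) is a after the first branch and - c after the second, so its
    sign reveals the branch taken. *)
Lemma step_inj d x y : simple d x -> simple d y -> step x = step y -> x = y.
Proof.
case: x => [[a b] c] /= /and3P[a0 c0 _]; case: y => [[a' b'] c'] /= /and3P[a0' c0' _].
have [h|h] := boolP (0 < a + b - c); have [h'|h'] := boolP (0 < a' + b' - c');
by case=> e1 e2 e3; first [exfalso; lia | congr (_, _, _); lia].
Qed.

(** * Integral changes of basis between simple forms *)

Lemma value_gt0_trans (a b c p q r t : int) : 0 < a -> 0 < c ->
  0 < p -> 0 < q -> 0 < r -> 0 < t -> p * t < q * r ->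
  0 < value (a, b, c) p (- q) -> 0 < value (a, b, c) r (- t).
Proof.
rewrite /= => a0 c0 p0 q0 r0 t0 hlt hf.
(* The polynomial a z^2 - b z - c is convex and negative at 0, so its positivity at z = p / q passes
   to the larger z = r / t. The identity [E] expresses this without division. *)
have pos : 0 < a * p - b * q by nia.
have E : (a * r ^+ 2 + b * r * - t - c * (- t) ^+ 2) * q ^+ 2 =
  t ^+ 2 * (a * p ^+ 2 + b * p * - q - c * (- q) ^+ 2)
  + (q * r - p * t) * (a * q * r + t * (a * p - b * q)) by ring.
rewrite -(@pmulr_lgt0 _ (q ^+ 2)) ?exprn_gt0 // E.
apply: addr_gt0; first by rewrite mulr_gt0 // exprn_gt0.
by rewrite mulr_gt0 ?subr_gt0 // addr_gt0 // ?mulr_gt0.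
Qed.

(** If q r < 0, then (p, q) and (r, t) lie, up to sign, in one open quadrant, and determinant 1
    places (r, t) nearer to the first axis. Positivity would then pass from (p, q) to (r, t). *)
Lemma act_signs d x (p q r t : int) : simple d x ->
  0 < value x p q -> value x r t < 0 -> p * t - q * r = 1 ->
  0 < p * t /\ 0 <= q * r.
Proof.
case: x => [[a b] c] /and3P[a0 c0 _] hpq hrt det.
have [qr|qr] := leP 0 (q * r); first by split=> //; lia.
exfalso.
have pt0 : p * t <= 0 by lia.
have p0 : p != 0.
  by apply/eqP => p0; move: hpq; rewrite p0 /= => ?; nia.
have t0 : t != 0.
  by apply/eqP => t0; move: hrt; rewrite t0 /= => ?; nia.
have neg u v : value (a, b, c) (- u) (- v) = value (a, b, c) u v by rewrite /=; ring.
have flip u v : value (a, b, c) u v = value (a, - b, c) u (- v) by rewrite /=; ring.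
wlog p_gt0 : p q r t hpq hrt det qr pt0 p0 t0 / 0 < p.
  move=> H; have [pp|pp] := ltP 0 p; first exact: (H p q r t).
  by apply: (H (- p) (- q) (- r) (- t)); rewrite ?neg ?oppr_eq0 // ?mulrNN //; lia.
have t_lt0 : t < 0 by nia.
have [q0|q0] := ltP 0 q.
  have r0 : r < 0 by nia.
  have := @value_gt0_trans a (- b) c p q (- r) (- t) a0 c0 p_gt0 q0.
  rewrite -flip -flip neg => /(_ _ _ _ hpq) H.
  have : 0 < value (a, b, c) r t by apply: H; lia.
  by rewrite ltNge ltW.
have q1 : q < 0.
  by rewrite lt_neqAle q0 andbT; apply/eqP => E; rewrite E mul0r ltxx in qr.
have r0 : 0 < r by rewrite -(nmulr_rlt0 _ q1).
have := @value_gt0_trans a b c p (- q) r (- t) a0 c0 p_gt0.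
rewrite !opprK => H.
have : 0 < value (a, b, c) r t by apply: H => //; lia.
by rewrite ltNge ltW.
Qed.

Lemma mul_eq1_ge0 (p t : int) : 0 <= p -> 0 <= t -> p * t = 1 -> p = 1 /\ t = 1.
Proof.
case: p => [p|p] //; case: t => [t|t] // _ _ [] /eqP.
by rewrite muln_eq1 => /andP[/eqP-> /eqP->].
Qed.

(** A nonnegative matrix of determinant 1 is a product of elementary ones. Each [step] strips one
    factor and lowers the sum of the entries, down to the identity. *)
Lemma act_ge0_iter_step (d : int) x y (p q r t : int) : (forall k : int, k ^+ 2 != d) ->
  simple d x -> simple d y -> y = act x p q r t -> p * t - q * r = 1 ->
  0 <= p -> 0 <= q -> 0 <= r -> 0 <= t -> exists k, y = iter k step x.
Proof.
move=> nsq sx sy; have [m] := ubnP (absz (p + q + r + t)).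
elim: m x p q r t sx => // m IH x p q r t sx hm Ey det p0 q0 r0 t0.
have [/andP[/eqP q_0 /eqP r_0]|nI] := boolP ((q == 0) && (r == 0)).
  have [p1 t1] : p = 1 /\ t = 1.
    by apply: mul_eq1_ge0 => //; rewrite -det q_0 mul0r subr0.
  exists 0%N; rewrite Ey p1 t1 q_0 r_0; case: (x) => [[a b] c] /=.
  by congr (_, _, _); ring.
have ssx := simple_step nsq sx.
suff [p' [q' [r' [t' [Ey' det' h0 /andP[hm' hm'']]]]]] : exists p' q' r' t' : int,
    [/\ y = act (step x) p' q' r' t', p' * t' - q' * r' = 1,
        [/\ 0 <= p', 0 <= q', 0 <= r' & 0 <= t'] &
        0 <= p' + q' + r' + t' < p + q + r + t].
  case: h0 => h1 h2 h3 h4; have lt_m : (absz (p' + q' + r' + t')%R < m)%N by lia.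
  have [k ->] := IH _ _ _ _ _ ssx lt_m Ey' det' h1 h2 h3 h4.
  by exists k.+1; rewrite iterSr.
have pt1 : 0 < p /\ 0 < t by nia.
(* Since [y] is simple, the sign rule also holds for the stripped matrix over [step x]. This shows
   that the branch chosen by [step] strips the right factor. *)
have sgn p' q' r' t' : y = act (step x) p' q' r' t' -> p' * t' - q' * r' = 1 ->
    0 < p' * t' /\ 0 <= q' * r'.
  move=> E' D'; apply: (act_signs ssx) D'.
    by move: sy; rewrite E' /act; case: (step x) => [[? ?] ?] /and3P[].
  by move: sy; rewrite E' /act; case: (step x) => [[? ?] ?] /and3P[_]; rewrite oppr_gt0.
case: x sx Ey {IH ssx} sgn => [[a b] c] sx Ey; rewrite /step.
have [h|h] := boolP (0 < a + b - c) => sgn.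
  (* Coordinates of (p, q) and (r, t) in the new basis (1, 1), (0, 1); the other branch uses the
     basis (1, 0), (1, 1). *)
  exists p, (q - p), r, (t - r).
  have E1 : y = act (a + b - c, b - 2 * c, c) p (q - p) r (t - r).
    by rewrite Ey /=; congr (_, _, _); ring.
  have D1 : p * (t - r) - (q - p) * r = 1 by rewrite -det; ring.
  have [s1 s2] := sgn _ _ _ _ E1 D1.
  have tr : 0 < t - r by nia.
  have qp : 0 <= q - p.
    have [r1|r1] := eqVneq r 0; last by rewrite -(@pmulr_lge0 _ r) // lt0r r1.
    move: nI det; rewrite r1 eqxx andbT mulr0 subr0 => q1 /(mul_eq1_ge0 p0 t0)[-> _].
    by lia.
  by split=> //; [split; lia | lia].
exists (p - q), q, (r - t), t.
have E1 : y = act (a, b + 2 * a, c - a - b) (p - q) q (r - t) t.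
  by rewrite Ey /=; congr (_, _, _); ring.
have D1 : (p - q) * t - q * (r - t) = 1 by rewrite -det; ring.
have [s1 s2] := sgn _ _ _ _ E1 D1.
have tr : 0 < p - q by nia.
have qp : 0 <= r - t.
  have [q1|q1] := eqVneq q 0; last by rewrite -(@pmulr_rge0 _ q) // lt0r q1.
  move: nI det; rewrite q1 eqxx mul0r subr0 => r1 /(mul_eq1_ge0 p0 t0)[_ ->].
  by lia.
by split=> //; [split; lia | lia].
Qed.

(** Up to a global sign the diagonal is positive and the off-diagonal entries do not have opposite
    signs. If these are nonpositive, the inverse matrix is nonnegative and the walk leads from [y]
    to [x]. *)
Lemma act_iter_step (d : int) x y (p q r t : int) : (forall k : int, k ^+ 2 != d) ->
  simple d x -> simple d y -> y = act x p q r t -> p * t - q * r = 1 ->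
  (exists k, y = iter k step x) \/ (exists k, x = iter k step y).
Proof.
move=> nsq sx sy.
wlog p0 : p q r t / 0 <= p.
  move=> H; have [pp|pp] := leP 0 p; first exact: (H p q r t).
  move=> E D; apply: (H (- p) (- q) (- r) (- t)); rewrite ?mulrNN ?oppr_ge0 ?ltW //.
  by rewrite E; case: (x) => [[a b] c] /=; congr (_, _, _); ring.
move=> E D; have [s1 s2] : 0 < p * t /\ 0 <= q * r.
  apply: (act_signs sx) D; move: sy; rewrite E.
    by case: (x) => [[? ?] ?] /and3P[].
  by case: (x) => [[? ?] ?] /and3P[_]; rewrite oppr_gt0.
have p1 : 0 < p by rewrite lt0r p0 andbT; apply/eqP => p_0; rewrite p_0 mul0r ltxx in s1.
have t1 : 0 < t by rewrite -(pmulr_rgt0 _ p1).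
have [/andP[q0 r0]|] := boolP ((0 <= q) && (0 <= r)).
  by left; apply: (act_ge0_iter_step nsq sx sy E D) => //; lia.
move=> H; have [q0 r0] : q <= 0 /\ r <= 0 by clear -s2 H; split; nia.
right; apply: (@act_ge0_iter_step d y x t (- q) (- r) p) => //; try lia.
rewrite E; case: (x) => [[a b] c] /=.
(* Multiplying one side by the squared determinant turns the claim into a polynomial identity. *)
have D2 : (p * t - q * r) ^+ 2 = 1 by rewrite D.
have scale z : z = z * (p * t - q * r) ^+ 2 by rewrite D2 mulr1.
by congr (_, _, _); rewrite [LHS]scale; ring.
Qed.

(* step permutes the finite set S, so S is also closed backwards along step. *)
Lemma iter_step_closed (d : int) (S : seq form) x y (p q r t : int) :
  (forall k : int, k ^+ 2 != d) -> {in S, forall z, simple d z} ->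
  {in S, forall z, step z \in S} ->
  simple d x -> y \in S -> x = act y p q r t -> p * t - q * r = 1 -> x \in S.
Proof.
move=> nsq Ss Sstep sx yS E D.
have back z : simple d z -> step z \in S -> z \in S.
  move=> sz zS.
  have stepU : uniq (map step (undup S)).
    rewrite map_inj_in_uniq ?undup_uniq // => u v; rewrite !mem_undup => uS vS.
    exact: step_inj (Ss _ uS) (Ss _ vS).
  have sub : {subset map step (undup S) <= undup S}.
    by move=> _ /mapP[u uS ->]; move: uS; rewrite !mem_undup; apply: Sstep.
  have [_ eqS] := uniq_min_size stepU sub (eq_leq (esym (size_map _ _))).
  have : step z \in map step (undup S) by rewrite eqS mem_undup.
  case/mapP=> u; rewrite mem_undup => uS /(step_inj sz (Ss _ uS)) -> //.
have [[k Ek]|[k Ek]] := act_iter_step nsq (Ss _ yS) sx E D.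
  by rewrite Ek; elim: (k) => //= l; apply: Sstep.
move: yS; rewrite Ek; elim: k {E Ek} => //= k IH H; apply: IH; apply: back => //.
by elim: k {H} => //= k IH; apply: simple_step.
Qed.

(** * The ring of integers *)

Lemma ratrD (x y : rat) : ratr (x + y) = ratr x + ratr y :> algC.
Proof. exact: rmorphD. Qed.

Lemma ratrB (x y : rat) : ratr (x - y) = ratr x - ratr y :> algC.
Proof. exact: rmorphB. Qed.

Lemma ratrM (x y : rat) : ratr (x * y) = ratr x * ratr y :> algC.
Proof. exact: rmorphM. Qed.

Lemma ratrX (x : rat) k : ratr (x ^+ k) = ratr x ^+ k :> algC.
Proof. exact: rmorphXn. Qed.

Lemma ratrV (x : rat) : ratr x^-1 = (ratr x)^-1 :> algC.
Proof. exact: fmorphV. Qed.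

Lemma int_parity (z : int) : exists v, z = 2 * v \/ z = 2 * v + 1.
Proof. by exists (z %/ 2)%Z; lia. Qed.

Section QuadraticOrder.

Variable d : nat.
Hypothesis d_sqfree : squarefree d.
Hypothesis d_gt1 : (1 < d)%N.

Local Notation s := (sqrtC d%:R : algC).

Lemma sqr_sqrt : s ^+ 2 = d%:R. Proof. exact: sqrtCK. Qed.

Lemma squarefree_sqr_dvd (u v : nat) : (v ^ 2 %| u ^ 2 * d)%N -> coprime u v -> v = 1%N.
Proof.
move=> H cuv; apply: d_sqfree; move: H; rewrite Gauss_dvdr // coprime_sym.
by rewrite coprimeXl // coprimeXr.
Qed.

Lemma squarefree_not_square (k : int) : k ^+ 2 != d%:Z.
Proof.
apply/eqP => /(congr1 absz); rewrite abszX absz_nat => E.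
have k1 : absz k = 1%N by apply: d_sqfree; rewrite E.
by move: d_gt1; rewrite -E k1.
Qed.

Lemma int_sqrt_free (A B : int) : A%:~R + B%:~R * s = 0 -> A = 0 /\ B = 0.
Proof.
move=> E; have {}E : A ^+ 2 = B ^+ 2 * d%:Z.
  apply: (@intr_inj algC); rewrite rmorphXn rmorphM rmorphXn /=.
  by rewrite -pmulrn -sqr_sqrt -exprMn -(addr0_eq E) sqrrN.
have [B0|B0] := eqVneq B 0.
  by move: E; rewrite B0 expr0n mul0r => /eqP; rewrite sqrf_eq0 => /eqP.
exfalso; have EN := congr1 absz E; rewrite abszM !abszX absz_nat in EN.
have : (absz B ^ 2 %| absz A ^ 2)%N by rewrite EN dvdn_mulr.
rewrite dvdn_pexp2r // => /dvdnP[k Ek].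
have := squarefree_not_square k%:Z; apply/negP; rewrite negbK; apply/eqP.
move: EN; rewrite Ek expnMn mulnC => /eqP.
by rewrite eqn_pmul2l ?expn_gt0 ?absz_gt0 ?B0 // => /eqP <-; rewrite -!natz natrX.
Qed.

Lemma rat_sqrt_free (a b : rat) : ratr a + ratr b * s = 0 -> a = 0 /\ b = 0.
Proof.
move=> E; have [n0 m0] := (denq_neq0 a, denq_neq0 b).
have : (numq a * denq b)%:~R + (numq b * denq a)%:~R * s = 0.
  move: E; rewrite /ratr => E.
  rewrite -[RHS](mulr0 ((denq b)%:~R * (denq a)%:~R)) -E.
  have [n1 m1] : (denq a)%:~R != 0 :> algC /\ (denq b)%:~R != 0 :> algC by rewrite !intr_eq0.
  by rewrite !rmorphM /=; field; rewrite n1 m1.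
case/int_sqrt_free => /eqP + /eqP; rewrite !mulf_eq0 (negPf n0) (negPf m0) !orbF !numq_eq0.
by move=> /eqP-> /eqP->.
Qed.

Lemma horner_rat_sqrt (p : {poly rat}) (a b : rat) : exists A B : rat,
  (map_poly ratr p).[ratr a + ratr b * s] = ratr A + ratr B * s /\
  (map_poly ratr p).[ratr a - ratr b * s] = ratr A - ratr B * s.
Proof.
elim/poly_ind: p => [|p c [A [B [E1 E2]]]].
  by exists 0, 0; rewrite !rmorph0 !horner0; split; ring.
exists (A * a + B * b * d%:R + c), (A * b + B * a).
have := sqr_sqrt; set t := s in E1 E2 * => Et.
rewrite rmorphD rmorphM /= map_polyX map_polyC /= !hornerE E1 E2 !(ratrD, ratrM) ratr_nat.
by rewrite -Et; split; ring.
Qed.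

(** The conjugate is a root of the same minimal polynomial, because 1 and [s] are independent over
    the rationals. *)
Lemma Aint_conj (a b : rat) :
  ratr a + ratr b * s \in Aint -> ratr a - ratr b * s \in Aint.
Proof.
set x := (ratr a + _) => xA.
apply: root_monic_Aint (minCpoly_monic x) xA.
have [p [Ep _] dv] := minCpolyP x; rewrite Ep.
have [A [B [E1 E2]]] := horner_rat_sqrt p a b.
have : root (map_poly ratr p) x by rewrite dv dvdpp.
rewrite /root E1 => /eqP /rat_sqrt_free [A0 B0].
by rewrite E2 A0 B0 !rmorph0 mul0r subr0.
Qed.

Lemma Aint_ratP (a : rat) : ratr a \in Aint -> exists A : int, a = A%:~R.
Proof.
move=> aA; have /intrP[A EA] := Cint_rat_Aint (Crat_rat a) aA.
by exists A; apply: (fmorph_inj (@ratr algC)); rewrite [LHS]EA [RHS]ratr_int.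
Qed.

Hypothesis d_mod4 : (d = 1 %[mod 4])%N.

Lemma d_mod4E : exists k : nat, d = (4 * k + 1)%N.
Proof. by exists (d %/ 4)%N; rewrite {1}(divn_eq d 4) mulnC d_mod4. Qed.

Definition tau (b : int) : algC := (b%:~R + s) / 2.

Definition lat (a b : int) : set algC :=
  [set z | exists x y : int, z = x%:~R * a%:~R + y%:~R * tau b].

Local Notation K := (quadratic_field d).
Local Notation O := (ring_of_integers K).

Lemma tau1_Aint : tau 1 \in Aint.
Proof.
have [k Ek] := d_mod4E.
(* With d = 4 k + 1, [tau 1] is a root of X^2 - X - k. *)
apply: (@root_monic_Aint ('X^2 - ('X + (k%:R)%:P))).
- rewrite /root !hornerE /tau.
  have -> : ((1%:~R + s) / 2) ^+ 2 = (1 + 2 * s + s ^+ 2) / 4 :> algC by field.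
  by rewrite sqr_sqrt Ek natrD natrM; apply/eqP; field.
- by rewrite monicE lead_coefDl ?lead_coefXn // size_polyXn size_polyN size_XaddC.
- apply/polyOverP=> i; rewrite coefB coefD coefXn coefX coefC.
  by rewrite !rpredB ?rpredD ?rpred_nat //; case: ifP; rewrite ?rpred_nat ?rpred0.
Qed.

(** The trace, the norm and the squared difference of the conjugates are rational algebraic
    integers, hence integers. Square-freeness of d then clears the denominator of 2 b. *)
Lemma ring_of_integersE : O = lat 1 1.
Proof.
apply/seteqP; split=> z /=; last first.
  case=> x [y ->]; split.
    exists (x%:~R + y%:~R / 2), (y%:~R / 2).
    by rewrite !(ratr_nat, ratr_int, ratrV, ratrM, ratrD) /tau; field.
  by rewrite rpredD // rpredM ?Aint_int ?tau1_Aint.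
have := sqr_sqrt; rewrite /tau => Et; case=> -[a [b ->]] zA.
have zA' := Aint_conj zA.
move: Et zA zA'; set t := s => Et zA zA'.
have [X EX] : exists X : int, 2 * a = X%:~R.
  apply: Aint_ratP; rewrite ratrM ratr_nat.
  rewrite (_ : _ * _ = (ratr a + ratr b * t) + (ratr a - ratr b * t)); last by ring.
  exact: rpredD.
have [M EM] : exists M : int, (2 * b) ^+ 2 * d%:R = M%:~R.
  apply: Aint_ratP; rewrite ratrM ratrX ratrM !ratr_nat -Et.
  rewrite (_ : _ * _ = (ratr a + ratr b * t - (ratr a - ratr b * t)) ^+ 2); last by ring.
  by apply: rpredX; apply: rpredB.
have [P EP] : exists P : int, a ^+ 2 - b ^+ 2 * d%:R = P%:~R.
  apply: Aint_ratP; rewrite ratrB ratrM !ratrX ratr_nat -Et.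
  rewrite (_ : _ - _ = (ratr a + ratr b * t) * (ratr a - ratr b * t)); last by ring.
  exact: rpredM.
have [Y EY] : exists Y : int, 2 * b = Y%:~R.
  exists (numq (2 * b)); rewrite -[LHS]divq_num_den.
  suff -> : denq (2 * b) = 1 by rewrite divr1.
  move: EM; set B := 2 * b => EM.
  have E : numq B ^+ 2 * d%:Z = M * denq B ^+ 2.
    apply: (@intr_inj rat); rewrite !intrM ?exprMn ?rmorphXn -pmulrn -EM numqE; ring.
  have := congr1 absz E; rewrite (abszM (numq B ^+ 2)) (abszM M) !abszX absz_nat => EN.
  have : absz (denq B) = 1%N.
    apply: (@squarefree_sqr_dvd (absz (numq B))); first by rewrite EN dvdn_mull.
    exact: coprime_num_den.
  by have := denq_gt0 B; lia.
have {}EP : X ^+ 2 = 4 * P + Y ^+ 2 * d%:Z.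
  apply: (@intr_inj rat); rewrite intrD !intrM ?rmorphXn -pmulrn -EX -EY -EP; ring.
have [k Ek] := d_mod4E.
(* [X] and [Y] have the same parity: by [EP] and d = 4 k + 1 the square of X - Y is even. *)
have [W EW] : exists W, X = Y + 2 * W.
  exists ((X - Y) %/ 2)%Z.
  have : ((X - Y) ^+ 2 = 2 * (2 * P - X * Y + Y ^+ 2 + 2 * k%:Z * Y ^+ 2)).
    rewrite sqrrB EP Ek PoszD PoszM; ring.
  have [v [Ev|Ev]] := int_parity (X - Y); first by lia.
  by rewrite Ev => E2; exfalso; lia.
exists W, Y; rewrite /tau.
have -> : a = (Y%:~R + 2 * W%:~R) / 2.
  by rewrite -[_ + _]/(Y%:~R + (2 : int)%:~R * _) -intrM -intrD -EW -EX; field.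
have -> : b = Y%:~R / 2 by rewrite -EY; field.
by rewrite !(ratr_nat, ratr_int, ratrV, ratrM, ratrD) -/t; field.
Qed.
End QuadraticOrder.

(** * Ideals and simple forms *)

(* The last two equations say (b1 + sqrt d)/(2 a1) = (r a2 + t tau2)/(p a2 + q tau2)
   with tau2 = (b2 + sqrt d)/2, separated into rational and irrational parts. *)
Lemma act_of_proportional (d a1 b1 c1 a2 b2 c2 p q r t D : int) :
  b1 ^+ 2 + 4 * a1 * c1 = d -> b2 ^+ 2 + 4 * a2 * c2 = d -> 0 < a1 -> 0 < a2 ->
  p * t - q * r = D -> D ^+ 2 = 1 ->
  b1 * (2 * p * a2 + q * b2) + q * d = 2 * a1 * (2 * r * a2 + t * b2) ->
  b1 * q + 2 * p * a2 + q * b2 = 2 * a1 * t ->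
  [/\ a1 = D * value (a2, b2, c2) p q, c1 = - D * value (a2, b2, c2) r t &
      b1 = D * (2 * a2 * p * r + b2 * (p * t + q * r) - 2 * c2 * q * t)].
Proof.
move=> e1 e2 a10 a20 eD D1 E1 E2.
have E1' : b1 * t + 2 * q * c1 = 2 * r * a2 + t * b2.
  apply: (@mulfI _ (2 * a1)); first by lia.
  rewrite -E1 -e1 (_ : 2 * p * a2 + q * b2 = 2 * a1 * t - b1 * q); last by lia.
  ring.
(* The inverse matrix has first row D (t, - q), so the first form takes the value D a2 at (t, - q).
   The three equations follow from this by cancelling a multiple of a2. *)
have F : a1 * t ^+ 2 - b1 * q * t - c1 * q ^+ 2 = D * a2.
  apply: (@mulfI _ 2) => //.
  transitivity (t * (2 * a1 * t - b1 * q) - q * (b1 * t + 2 * q * c1)); first by ring.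
  by rewrite E1' -eD (_ : 2 * a1 * t - b1 * q = 2 * p * a2 + q * b2); [ring|lia].
have two_a2 : 2 * a2 != 0 by lia.
have sc (u v : int) : 2 * a2 * u = 2 * a2 * (D * v) -> D * u = v.
  by move/(mulfI two_a2) ->; rewrite mulrA -expr2 D1 mul1r.
have G : 2 * p * a2 + q * b2 = 2 * a1 * t - b1 * q by lia.
rewrite /=; split.
- apply/esym/sc; apply: (@mulfI _ 2) => //.
  transitivity ((2 * p * a2 + q * b2) ^+ 2 - d * q ^+ 2); first by rewrite -e2; ring.
  transitivity (4 * a1 * (D * a2)); last by ring.
  by rewrite -F -e1 G; ring.
- rewrite mulNr; apply/eqP; rewrite -eqr_oppLR; apply/eqP/esym/sc; apply: (@mulfI _ 2) => //.
  transitivity ((2 * r * a2 + t * b2) ^+ 2 - d * t ^+ 2); first by rewrite -e2; ring.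
  transitivity (- 4 * c1 * (D * a2)); last by ring.
  by rewrite -F -e1 -E1'; ring.
apply/esym/sc.
transitivity ((2 * p * a2 + q * b2) * (2 * r * a2 + t * b2) - d * q * t).
  by rewrite -e2; ring.
transitivity (2 * b1 * (D * a2)); last by ring.
by rewrite -F -e1 -E1' G; ring.
Qed.

Section IdealClasses.

Variable d : nat.
Hypothesis d_sqfree : squarefree d.
Hypothesis d_gt1 : (1 < d)%N.
Hypothesis d_mod4 : (d = 1 %[mod 4])%N.

Local Notation s := (sqrtC d%:R : algC).
Local Notation tau := (tau d).
Local Notation lat := (lat d).
Local Notation O := (ring_of_integers (quadratic_field d)).

Lemma tau_shift (b m : int) : tau (b + 2 * m) = tau b + m%:~R.
Proof. by rewrite /tau intrD intrM; field. Qed.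

Lemma tau_mul_opp (a b c : int) : b ^+ 2 + 4 * a * c = d%:Z ->
  tau b * tau (- b) = a%:~R * c%:~R.
Proof.
move=> /(congr1 (intmul (1 : algC))); have := sqr_sqrt d.
rewrite /tau intrD 2!intrM -pmulrn; set t := s => <- E.
have -> : a%:~R * c%:~R = (4 * (a%:~R * c%:~R)) / 4 :> algC by field.
rewrite -[4](_ : (4 : int)%:~R = 4) // mulrA.
have -> : (4 : int)%:~R * a%:~R * c%:~R = t ^+ 2 - (b ^+ 2)%:~R by rewrite -E; ring.
by rewrite expr2 intrM rmorphN /=; field.
Qed.

Lemma tau_opp (b : int) : tau (- b) = tau b - b%:~R.
Proof. by rewrite /tau rmorphN /=; field. Qed.

Lemma tau_sqr (a b c : int) : b ^+ 2 + 4 * a * c = d%:Z ->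
  tau b ^+ 2 = b%:~R * tau b + a%:~R * c%:~R.
Proof. by move=> /tau_mul_opp <-; rewrite tau_opp; ring. Qed.

Lemma lat_shift (a b m : int) : lat a (b + 2 * a * m) = lat a b.
Proof.
rewrite -mulrA; apply/seteqP; split=> z /= [x [y ->]]; rewrite ?tau_shift.
  by exists (x + y * m), y; rewrite !(intrD, intrM); ring.
by exists (x - y * m), y; rewrite tau_shift !(intrD, intrM, rmorphN) /=; ring.
Qed.

Lemma lat_opp (a b : int) : lat (- a) b = lat a b.
Proof.
by apply/seteqP; split=> z /= [x [y ->]]; exists (- x), y; rewrite !rmorphN /=; ring.
Qed.

Lemma lat_free (a b x y : int) : a != 0 ->
  x%:~R * a%:~R + y%:~R * tau b = 0 -> x = 0 /\ y = 0.
Proof.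
move=> a0 E; have : (2 * x * a + y * b)%:~R + y%:~R * s = 0.
  by rewrite -[RHS](mulr0 2) -E /tau !(intrD, intrM); field.
case/(int_sqrt_free d_sqfree d_gt1) => + y0; rewrite y0 mul0r addr0 => /eqP.
by rewrite !mulf_eq0 (negPf a0) orbF /= => /eqP ->.
Qed.

(** As d is odd, so is b, and O is also spanned by 1 and [tau b]. The relation (tau b)^2 = b tau b +
    a c keeps the lattice stable under [tau b]. *)
Lemma lat_ideal (a b c : int) : b ^+ 2 + 4 * a * c = d%:Z -> is_ideal O (lat a b).
Proof.
move=> E; rewrite (ring_of_integersE d_sqfree d_gt1 d_mod4).
have [k Ek] := d_mod4E d_mod4.
have [v [Ev|Ev]] := int_parity b.
  by exfalso; move: E; rewrite Ev Ek; lia.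
have tb : tau b = tau 1 + v%:~R by rewrite Ev addrC tau_shift.
have tb' : tau 1 = tau b - v%:~R by rewrite tb; ring.
split.
- move=> z [x [y ->]]; exists (x * a + y * v), y.
  by rewrite tb !(intrD, intrM); ring.
- by exists 0, 0; rewrite !mul0r addr0.
- move=> _ _ [x [y ->]] [x' [y' ->]]; exists (x + x'), (y + y').
  by rewrite !intrD; ring.
move=> _ _ [x [y ->]] [X [Y ->]].
exists ((x - y * v) * X + y * Y * c), ((x - y * v) * Y + y * X * a + y * Y * b).
rewrite tb' !(intrD, intrM, rmorphN) /=.
transitivity ((x%:~R - y%:~R * v%:~R) * (X%:~R * a%:~R + Y%:~R * tau b) +
   y%:~R * (X%:~R * a%:~R * tau b + Y%:~R * tau b ^+ 2)); first by ring.
by rewrite (tau_sqr E); ring.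
Qed.

Lemma ring_of_integersM x y : O x -> O y -> O (x * y).
Proof.
move=> [[a [b ->]] xA] [[a' [b' ->]] yA]; split; last exact: rpredM.
exists (a * a' + b * b' * d%:R), (a * b' + b * a').
have := sqr_sqrt d; rewrite !(ratr_nat, ratrM, ratrD); set t := s => <-; ring.
Qed.

Lemma ring_of_integers_int (m : int) : O m%:~R.
Proof.
split; last exact: Aint_int.
by exists m%:~R, 0; rewrite ratr_int rmorph0 mul0r addr0.
Qed.

Lemma ideal_equiv_refl I : ideal_equiv O I I.
Proof.
have O1 := ring_of_integers_int 1.
by exists 1, 1; split; rewrite ?oner_neq0.
Qed.

Lemma ideal_equiv_sym I J : ideal_equiv O I J -> ideal_equiv O J I.
Proof. by case=> a [b [Oa Ob E]]; exists b, a; split. Qed.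

Lemma ideal_equiv_trans I J L :
  ideal_equiv O I J -> ideal_equiv O J L -> ideal_equiv O I L.
Proof.
case=> a [b [[Oa a0] [Ob b0] E]] [a' [b' [[Oa' a0'] [Ob' b0'] E']]].
exists (a' * a), (b * b'); split; try by split; rewrite ?mulf_neq0 //; apply: ring_of_integersM.
have comp (u v : algC) (A : set algC) :
    [set u * v * x | x in A] = [set u * x | x in [set v * x | x in A]].
  apply/seteqP; split=> z /=; first by move=> [x xA <-]; exists (v * x); [exists x|rewrite mulrA].
  by move=> [_ [x xA <-] <-]; exists x; rewrite ?mulrA.
by rewrite comp E -comp (mulrC a') (comp b a') E' -comp.
Qed.

Lemma ring_of_integers_tau (a b c : int) : b ^+ 2 + 4 * a * c = d%:Z -> O (tau b).
Proof.
by move=> /lat_ideal[sub _ _ _]; apply: sub; exists 0, 1; rewrite mul0r add0r mul1r.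
Qed.

Lemma tau_neq0 (b : int) : tau b != 0.
Proof.
apply/eqP => E; have [] := @lat_free 1 b 0 1 isT; last by [].
by rewrite mul0r add0r E mulr0.
Qed.

(** Since [tau b * tau (- b)] equals a c, c times the first lattice and [tau b] times the second are
    both spanned by a c and c [tau b]. *)
Lemma lat_swap (a b c : int) : b ^+ 2 + 4 * a * c = d%:Z -> c != 0 ->
  ideal_equiv O (lat a b) (lat c (- b)).
Proof.
move=> E c0; exists c%:~R, (tau b); split.
- by split; [exact: ring_of_integers_int|rewrite intr_eq0].
- by split; [exact: ring_of_integers_tau E|exact: tau_neq0].
have M := tau_mul_opp E.
apply/seteqP; split=> z /= [_ [x [y ->]] <-].
  exists (y%:~R * c%:~R + x%:~R * tau (- b)); first by exists y, x.
  rewrite [LHS](_ : _ = y%:~R * c%:~R * tau b + x%:~R * (tau b * tau (- b))); last by ring.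
  by rewrite M; ring.
exists (y%:~R * a%:~R + x%:~R * tau b); first by exists y, x.
rewrite [RHS](_ : _ = x%:~R * c%:~R * tau b + y%:~R * (tau b * tau (- b))); last by ring.
by rewrite M; ring.
Qed.

Definition ideal_of (x : form) : set algC := let: (a, b, _) := x in lat a b.

Lemma ideal_of_swap x : simple d%:Z x -> ideal_equiv O (ideal_of x) (ideal_of (swap x)).
Proof.
by case: x => [[a b] c] /= /and3P[a0 c0 /eqP E]; apply: (lat_swap E); rewrite gt_eqF.
Qed.

(** The second branch shifts b by 2 a and keeps the lattice; the first branch is such a shift
    between two swaps. *)
Lemma ideal_of_step x : simple d%:Z x -> ideal_equiv O (ideal_of x) (ideal_of (step x)).
Proof.
move=> sx; have := sx; case: x sx => [[a b] c] sx /and3P[a0 c0 /eqP E]; rewrite [step _]/=.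
case: ifP => h /=.
  apply: (ideal_equiv_trans (ideal_of_swap sx)) => /=.
  rewrite -(lat_shift c (- b) 1) mulr1.
  rewrite -[b - 2 * c](opprK (b - 2 * c)) -[- (b - 2 * c)](_ : - b + 2 * c = _); last by ring.
  by apply: (@lat_swap _ _ (a + b - c)); [rewrite -E; ring|rewrite gt_eqF].
by rewrite -(lat_shift a b 1) mulr1; apply: ideal_equiv_refl.
Qed.

Lemma ideal_of_ideal x : simple d%:Z x -> nonzero_ideal O (ideal_of x).
Proof.
case: x => [[a b] c] /= /and3P[a0 c0 /eqP E]; split; first exact: lat_ideal E.
by exists a%:~R; [exists 1, 0; rewrite mul1r mul0r addr0|rewrite intr_eq0 gt_eqF].
Qed.

(** Proportional lattices differ by an invertible integer matrix, of determinant 1 or -1.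
    Determinant -1 is turned into 1 by exchanging coordinates, at the cost of a swap. *)
Lemma ideal_equiv_act x y : simple d%:Z x -> simple d%:Z y ->
  ideal_equiv O (ideal_of x) (ideal_of y) ->
  exists p q r t : int,
    p * t - q * r = 1 /\ (x = act y p q r t \/ x = act (swap y) p q r t).
Proof.
case: x => [[a1 b1] c1] /and3P[a10 c10 /eqP e1]; case: y => [[a2 b2] c2] /and3P[a20 c20 /eqP e2].
case=> u [v [[_ u0] [_ v0] E]]; rewrite /ideal_of in E.
have fromE z : lat a1 b1 z -> exists p q : int, u * z = v * (p%:~R * a2%:~R + q%:~R * tau b2).
  move=> zL; have : [set u * x | x in lat a1 b1] (u * z) by exists z.
  by rewrite E => -[_ [p [q ->]] <-]; exists p, q.
have toE z : lat a2 b2 z -> exists p q : int, v * z = u * (p%:~R * a1%:~R + q%:~R * tau b1).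
  move=> zL; have : [set v * x | x in lat a2 b2] (v * z) by exists z.
  by rewrite -E => -[_ [p [q ->]] <-]; exists p, q.
have l1 a b : lat a b a%:~R by exists 1, 0; rewrite mul1r mul0r addr0.
have l2 a b : lat a b (tau b) by exists 0, 1; rewrite mul1r mul0r add0r.
have [p [q Ep]] := fromE _ (l1 a1 b1); have [r [t Er]] := fromE _ (l2 a1 b1).
have [p' [q' Ep']] := toE _ (l1 a2 b2); have [r' [t' Er']] := toE _ (l2 a2 b2).
have a2n : a2 != 0 by rewrite gt_eqF.
(* The two matrices are inverse to each other, because a2 and [tau b2] are independent over the
   integers. *)
have [z1 z2] : p' * p + q' * r - 1 = 0 /\ p' * q + q' * t = 0.
  apply: (@lat_free a2 b2) => //; apply: (mulfI v0); rewrite mulr0.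
  transitivity (p'%:~R * (v * (p%:~R * a2%:~R + q%:~R * tau b2)) +
    q'%:~R * (v * (r%:~R * a2%:~R + t%:~R * tau b2)) - v * a2%:~R).
    by rewrite !(intrD, intrM, rmorphN) /=; ring.
  by rewrite -Ep -Er Ep'; ring.
have [z3 z4] : r' * p + t' * r = 0 /\ r' * q + t' * t - 1 = 0.
  apply: (@lat_free a2 b2) => //; apply: (mulfI v0); rewrite mulr0.
  transitivity (r'%:~R * (v * (p%:~R * a2%:~R + q%:~R * tau b2)) +
    t'%:~R * (v * (r%:~R * a2%:~R + t%:~R * tau b2)) - v * tau b2).
    by rewrite !(intrD, intrM, rmorphN) /=; ring.
  by rewrite -Ep -Er Er'; ring.
set D := p * t - q * r.
have DD : D * (p' * t' - q' * r') = 1.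
  transitivity ((p' * p + q' * r) * (r' * q + t' * t) - (p' * q + q' * t) * (r' * p + t' * r)).
    by rewrite /D; ring.
  by rewrite z2 z3 (_ : p' * p + q' * r = 1) 1?(_ : r' * q + t' * t = 1); lia.
have D1 : (D == 1) || (D == -1).
  have /eqP : (absz D * absz (p' * t' - q' * r')%R = 1)%N by rewrite -abszM DD.
  by rewrite muln_eq1 => /andP[/eqP D1 _]; lia.
(* Dividing [Er] by [Ep] eliminates [u] and [v] and leaves an equation for [tau b1] / a1. *)
have X : a1%:~R * (r%:~R * a2%:~R + t%:~R * tau b2) = tau b1 * (p%:~R * a2%:~R + q%:~R * tau b2).
  apply: (mulfI (mulf_neq0 u0 v0)).
  transitivity ((u * a1%:~R) * (v * (r%:~R * a2%:~R + t%:~R * tau b2))); first by ring.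
  by rewrite -Er Ep; ring.
have [E1 E2] : b1 * (2 * p * a2 + q * b2) + q * d%:Z - 2 * a1 * (2 * r * a2 + t * b2) = 0 /\
    b1 * q + 2 * p * a2 + q * b2 - 2 * a1 * t = 0.
  apply: (int_sqrt_free d_sqfree d_gt1).
  move/eqP: X; rewrite -subr_eq0 => /eqP /(congr1 (fun z => - 4 * z)); rewrite mulr0 => <-.
  have S : (d%:Z)%:~R = s ^+ 2 by rewrite sqr_sqrt -pmulrn.
  by rewrite !(intrD, intrM, rmorphN) /= S /tau; field.
have Dsq : D ^+ 2 = 1 by case/orP: D1 => /eqP->.
have [||A C B] := @act_of_proportional d%:Z a1 b1 c1 a2 b2 c2 p q r t D e1 e2 a10 a20 erefl Dsq.
- by lia.
- by lia.
case/orP: D1 => /eqP D1; rewrite D1 ?mul1r ?mulN1r ?opprK ?mul1r in A B C.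
  exists p, q, r, t; split; first exact: D1.
  by left; rewrite A B C.
exists q, p, t, r; split; first by rewrite /D in D1; lia.
by right; rewrite A B C /=; congr (_, _, _); ring.
Qed.
End IdealClasses.

Section SimpleFormsInClasses.

Variable d : nat.
Hypothesis d_sqfree : squarefree d.
Hypothesis d_gt1 : (1 < d)%N.
Hypothesis d_mod4 : (d = 1 %[mod 4])%N.

Local Notation tau := (tau d).
Local Notation lat := (lat d).
Local Notation O := (ring_of_integers (quadratic_field d)).
Local Notation ideal_of := (ideal_of d).

(** This makes such a set a union of full classes; stability under [swap] settles the second
    alternative of [ideal_equiv_act]. *)
Lemma equiv_mem_closed (S : seq form) x y :
  {in S, forall z, simple d%:Z z} -> {in S, forall z, step z \in S} ->
  {in S, forall z, swap z \in S} -> simple d%:Z x -> y \in S ->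
  ideal_equiv O (ideal_of x) (ideal_of y) -> x \in S.
Proof.
move=> Ss Sstep Sswap sx yS /(ideal_equiv_act d_sqfree d_gt1 d_mod4 sx (Ss _ yS)).
have close := iter_step_closed (squarefree_not_square d_sqfree d_gt1) Ss Sstep sx.
by case=> p [q [r [t [D [E|E]]]]]; apply: close E D => //; apply: Sswap.
Qed.

Lemma least_pos_int (P : int -> Prop) :
  (exists2 z, P z & 0 < z) -> exists2 z, P z & 0 < z /\ forall w, P w -> 0 < w -> z <= w.
Proof.
case=> z Pz z0; have ex : exists m : nat, `[< P m%:Z /\ (0 < m)%N >].
  by exists (absz z); apply/asboolP; rewrite gez0_abs ?ltW // absz_gt0 gt_eqF.
case: (ex_minnP ex) => m /asboolP[Pm m0] mmin; exists m%:Z => //; split=> // w Pw w0.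
have /mmin : `[< P (absz w)%:Z /\ (0 < absz w)%N >].
  by apply/asboolP; rewrite gez0_abs ?ltW // absz_gt0 gt_eqF.
by lia.
Qed.

Lemma subgroup_int_cyclic (P : int -> Prop) :
  (forall x y, P x -> P y -> P (x - y)) -> (exists2 z, P z & z != 0) ->
  exists2 g, P g /\ 0 < g & forall x, P x -> exists m, x = m * g.
Proof.
move=> PB [z0 Pz0 z00].
have P0 : P 0 by rewrite -(subrr z0); apply: PB.
have PN x : P x -> P (- x) by rewrite -sub0r; apply: PB.
have PM m x : P x -> P (m * x).
  move=> Px; have nat_mul k : P (k%:Z * x).
    elim: k => [|k IH]; first by rewrite mul0r.
    by rewrite (_ : k.+1%:Z * x = k%:Z * x - (- x)); [apply/PB/PN|rewrite intS; ring].
  by case: m => k //; rewrite NegzE mulNr; apply: PN.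
have [|g Pg [g0 gmin]] := @least_pos_int P.
  by exists `|z0|; rewrite ?normr_gt0 //; case: (ger0P z0) => // _; apply: PN.
exists g; first by split.
move=> x Px; exists (x %/ g)%Z; have E := divz_eq x g.
suff : (x %% g)%Z = 0 by lia.
apply/eqP; apply/negPn/negP => nz.
have := modz_ge0 x (_ : g != 0); have := ltz_pmod x g0.
have : P (x %% g)%Z.
  rewrite (_ : (x %% g)%Z = x - (x %/ g)%Z * g); last by lia.
  by apply: PB => //; apply: PM.
move=> /gmin H h1 h2; have := h2 _; lia.
Qed.

(** Hermite normal form: with A generating the integers in I and g generating the coefficients of
    [tau 1] in I, the ideal is spanned by A and some x0 + g [tau 1], and g divides both A and x0. *)
Lemma ideal_lat I : nonzero_ideal O I -> exists a b c : int,
  [/\ 0 < a, b ^+ 2 + 4 * a * c = d%:Z & ideal_equiv O I (lat a b)].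
Proof.
have OE := ring_of_integersE d_sqfree d_gt1 d_mod4.
have [k Ek] := d_mod4E d_mod4.
have tau2 : tau 1 ^+ 2 = tau 1 + k%:R.
  rewrite (@tau_sqr d 1 1 k) ?mulr1z ?mul1r -?pmulrn //.
  by rewrite Ek PoszD PoszM; ring.
have Oxy (x y : int) : O (x%:~R + y%:~R * tau 1) by rewrite OE; exists x, y; rewrite mulr1.
case=> -[IO I0 ID IM] [z0 Iz0 z00].
have IB x y : I x -> I y -> I (x - y).
  move=> Ix Iy; apply: ID => //; rewrite -mulN1r; apply: IM => //.
  by have := Oxy (- 1) 0; rewrite mul0r addr0.
have IZ (m : int) x : I x -> I (m%:~R * x).
  by apply: IM; have := Oxy m 0; rewrite mul0r addr0.
(* The second factor is the conjugate of the first, so the product is the norm. *)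
have conj (x y : int) : (x%:~R + y%:~R * tau 1) * ((x + y)%:~R + (- y)%:~R * tau 1) =
    (x ^+ 2 + x * y - k%:Z * y ^+ 2)%:~R.
  rewrite [LHS](_ : _ = x%:~R ^+ 2 + x%:~R * y%:~R + y%:~R ^+ 2 * tau 1 - y%:~R ^+ 2 * tau 1 ^+ 2).
    by rewrite tau2 !(intrD, intrM, rmorphN) /= ?intrM -?pmulrn; ring.
  by rewrite !(intrD, rmorphN) /=; ring.
have free (x y : int) : x%:~R + y%:~R * tau 1 = 0 -> x = 0 /\ y = 0.
  by move=> E; apply: (@lat_free d d_sqfree d_gt1 1 1) => //; rewrite mulr1.
have [A [IA A0] Adiv] : exists2 A : int, I A%:~R /\ 0 < A &
    forall x : int, I x%:~R -> exists m, x = m * A.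
  apply: (@subgroup_int_cyclic (fun x : int => I x%:~R)).
    by move=> x y Ix Iy; rewrite intrD rmorphN; apply: IB.
  move: (IO _ Iz0); rewrite OE => -[x [y]]; rewrite mulr1 => Ez.
  exists (x ^+ 2 + x * y - k%:Z * y ^+ 2).
    by rewrite -conj mulrC; apply: IM; [exact: Oxy|rewrite -Ez].
  apply/eqP => N0; have := conj x y; rewrite N0 => /eqP; rewrite mulf_eq0 -Ez (negPf z00) /=.
  move=> /eqP/free[xy y0]; move: z00; rewrite Ez.
  have -> : y = 0 by lia.
  have -> : x = 0 by lia.
  by rewrite mul0r addr0 eqxx.
have [g [[x0 Ie] g0] gdiv] : exists2 g : int, (exists x : int, I (x%:~R + g%:~R * tau 1)) /\ 0 < g &
    forall y : int, (exists x : int, I (x%:~R + y%:~R * tau 1)) -> exists m, y = m * g.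
  apply: (@subgroup_int_cyclic (fun y : int => exists x : int, I (x%:~R + y%:~R * tau 1))).
    move=> y y' [x Ix] [x' Ix']; exists (x - x').
    rewrite (_ : _ + _ = (x%:~R + y%:~R * tau 1) - (x'%:~R + y'%:~R * tau 1)); first exact: IB.
    by rewrite !(intrD, rmorphN) /=; ring.
  exists A; last by rewrite gt_eqF.
  exists 0; rewrite add0r mulrC; apply: IM => //.
  by have := Oxy 0 1; rewrite add0r mul1r.
have Otau : O (tau 1) by have := Oxy 0 1; rewrite add0r mul1r.
have [a Ea] : exists a, A = a * g.
  by apply: gdiv; exists 0; rewrite add0r mulrC; apply: IM.
(* Multiplication of x0 + g [tau 1] by [tau 1] gives an element whose coefficient of [tau 1] is x0 +
   g. *)
have [v Ev] : exists v, x0 = v * g.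
  have [m Em] : exists m, x0 + g = m * g.
    apply: gdiv; exists (g * k%:Z).
    rewrite (_ : _ + _ = tau 1 * (x0%:~R + g%:~R * tau 1)); first exact: IM.
    rewrite mulrDr [tau 1 * (g%:~R * _)](_ : _ = g%:~R * tau 1 ^+ 2); last by ring.
    by rewrite tau2 !(intrD, intrM) -pmulrn; ring.
  by exists (m - 1); lia.
have a0 : 0 < a by rewrite -(pmulr_lgt0 _ g0) -Ea.
(* Multiplying g (v + [tau 1]) by the conjugate of v + [tau 1] gives the integer g (v^2 + v - k) in
   I, hence a multiple of A = a g. *)
have [c Ec] : exists c, v ^+ 2 + v - k%:Z = c * a.
  have [m Em] : exists m, g * (v ^+ 2 + v - k%:Z) = m * A.
    apply: Adiv.
    rewrite [_%:~R](_ : _ =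
      ((v + 1)%:~R + (- 1)%:~R * tau 1) * (x0%:~R + g%:~R * tau 1)).
      by apply: IM.
    have := conj v 1; rewrite mul1r mulr1 expr1n mulr1 => C.
    rewrite intrM -C Ev !intrM; ring.
  exists m; apply: (@mulfI _ g); first by rewrite gt_eqF.
  by rewrite Em Ea; ring.
exists a, (2 * v + 1), (- c); split=> //.
  by rewrite (_ : _ + _ = 4 * (v ^+ 2 + v - c * a) + 1); [rewrite -Ec Ek; lia|ring].
have tb : tau (2 * v + 1) = v%:~R + tau 1 by rewrite addrC tau_shift addrC.
exists 1, g%:~R; split.
- by split; rewrite ?oner_neq0 //; have := Oxy 1 0; rewrite mul0r addr0.
- by split; rewrite ?intr_eq0 ?gt_eqF //; have := Oxy g 0; rewrite mul0r addr0.
apply/seteqP; split=> z /=; last first.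
  move=> [w [x [y Ew]] <-]; exists (g%:~R * w); last by rewrite mul1r.
  rewrite Ew.
  rewrite (_ : _ * _ = x%:~R * A%:~R + y%:~R * (x0%:~R + g%:~R * tau 1)).
    by apply: ID; apply: IZ.
  by rewrite tb Ea Ev !intrM; ring.
move=> [w Iw <-]; rewrite mul1r.
have := IO _ Iw; rewrite OE => -[x [y]]; rewrite mulr1 => Ew.
have [m Em] : exists m, y = m * g by apply: gdiv; exists x; rewrite -Ew.
have [l El] : exists l, x - m * x0 = l * A.
  apply: Adiv; rewrite (_ : _%:~R = w - m%:~R * (x0%:~R + g%:~R * tau 1)).
    by apply: IB => //; apply: IZ.
  by rewrite Ew Em !(intrD, intrM, rmorphN) /= intrM; ring.
exists (l%:~R * a%:~R + m%:~R * tau (2 * v + 1)); first by exists l, m.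
rewrite Ew Em (_ : x = l * A + m * x0); last by lia.
by rewrite tb Ea Ev !(intrD, intrM); ring.
Qed.

(* Descent on a: with |b| <= a, either c > 0, or 0 < -c < a and the roles of a and
   -c can be exchanged. *)
Lemma lat_simple (a b c : int) : 0 < a -> b ^+ 2 + 4 * a * c = d%:Z ->
  exists2 x, simple d%:Z x & ideal_equiv O (lat a b) (ideal_of x).
Proof.
have [m] := ubnP (absz a); elim: m a b c => // m IH a b c hm a0 E.
(* Reduction of b modulo 2 a into the interval from - a to a. *)
pose u := ((b + a) %/ (2 * a))%Z.
pose b' := ((b + a) %% (2 * a))%Z - a.
have a20 : 0 < 2 * a by lia.
have Eb : b = b' + 2 * a * u.
  by rewrite /b' /u; have := divz_eq (b + a) (2 * a); lia.
have bB : - a <= b' < a.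
  have := modz_ge0 (b + a) (_ : 2 * a != 0); rewrite gt_eqF // => /(_ isT).
  by have := ltz_pmod (b + a) a20; rewrite /b'; lia.
rewrite Eb (lat_shift d).
pose c' := c + b' * u + a * u ^+ 2.
have E' : b' ^+ 2 + 4 * a * c' = d%:Z by rewrite -E /c' Eb; ring.
have c'0 : c' != 0.
  apply/eqP => c0; have := squarefree_not_square d_sqfree d_gt1 b'.
  by rewrite -E' c0 mulr0 addr0 eqxx.
have [c'p|c'n] := ltP 0 c'.
  exists (a, b', c'); first by rewrite /= a0 c'p E' eqxx.
  exact: ideal_equiv_refl.
have sq : b' ^+ 2 <= a ^+ 2.
  by rewrite -subr_ge0 subr_sqr mulr_ge0; lia.
have lt_ca : - c' < a.
  (* Otherwise 4 a^2 <= - 4 a c' = b'^2 - d, against b'^2 <= a^2. *)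
  rewrite ltNge; apply/negP => le_ac; have := ler_wpM2l (ltW a0) le_ac.
  have := sqr_ge0 a; rewrite -expr2; lia.
have [|||x sx ex] := IH (- c') (- b') (- a).
- by clear -hm lt_ca a0 c'n; lia.
- by lia.
- by rewrite -E'; ring.
exists x => //; apply: ideal_equiv_trans ex; rewrite lat_opp.
exact: (lat_swap d_sqfree d_gt1 d_mod4 E' c'0).
Qed.

Lemma ideal_simple I : nonzero_ideal O I ->
  exists2 x, simple d%:Z x & ideal_equiv O I (ideal_of x).
Proof.
case/ideal_lat=> a [b [c [a0 E e]]]; have [x sx ex] := lat_simple a0 E.
by exists x => //; apply: ideal_equiv_trans ex.
Qed.
End SimpleFormsInClasses.

(** * The closed walk attached to a factorisation *)

(** The form (p, e - n, m) after the substitution of x + i y for x, which is what i uses of the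
    second branch of [step] amount to. *)
Definition arc (e n p m i : int) : form :=
  (p, e + 2 * p * i - n, m + (n - e) * i - p * i ^+ 2).

Lemma arc_step (e n p m i : int) : 0 < m + (n - e) * (i + 1) - p * (i + 1) ^+ 2 ->
  step (arc e n p m i) = arc e n p m (i + 1).
Proof.
move=> h; rewrite /step /arc ifF; last first.
  by apply/negbTE; lia.
by congr (_, _, _); ring.
Qed.

(* The full walk is half_cycle followed by its image under swap: the two arcs have
   leading coefficients p and m, and meet the arcs of the swapped half at their ends. *)
Definition half_cycle (e g p m : nat) : seq form :=
  let n := (g * p * m)%:Z in
  [seq arc e%:Z n p%:Z m%:Z i%:Z | i <- index_iota 1 (g * m)] ++
  [seq arc (- e%:Z) n m%:Z (- p%:Z) i%:Z | i <- index_iota 1 (g * p).+1].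

Definition cycle_of (e g p m : nat) : seq form :=
  half_cycle e g p m ++ map swap (half_cycle e g p m).

Section Cycle.

Variables e g p m : nat.
Hypothesis eg : (e = 2%N /\ g = 1%N) \/ (e = 1%N /\ g = 2%N).
Hypothesis p_gt0 : (0 < p)%N.
Hypothesis m_gt2 : (2 < m)%N.

Local Notation n := (g * p * m)%N.
Local Notation arcA i := (arc e%:Z n%:Z p%:Z m%:Z i%:Z).
Local Notation arcB i := (arc (- e%:Z) n%:Z m%:Z (- p%:Z) i%:Z).
Local Notation H := (half_cycle e g p m).
Local Notation C := (cycle_of e g p m).
Local Notation d := (n ^ 2 + e ^ 2)%N.

Lemma arcA_pos (i : nat) : (i < g * m)%N ->
  0 < m%:Z + (n%:Z - e%:Z) * i%:Z - p%:Z * i%:Z ^+ 2.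
Proof.
move=> lt_i; pose j := (g * m - i)%N.
have Ej : (g * m = i + j)%N by rewrite /j; lia.
have j0 : (0 < j)%N by rewrite /j; lia.
have -> : n%:Z = p%:Z * (i%:Z + j%:Z) by rewrite -PoszD -Ej; lia.
rewrite (_ : _ - _ = m%:Z + i%:Z * (p%:Z * j%:Z - e%:Z)); last by ring.
have [pj|pj] := leqP e (p * j).
  have : 0 <= i%:Z * (p%:Z * j%:Z - e%:Z) by rewrite mulr_ge0 //; lia.
  by lia.
(* The only remaining case is e = 2, g = 1 and p = j = 1; then i = m - 1 and the value is 1. *)
have [j1 p1] : j = 1%N /\ p = 1%N by case: eg => -[? _]; split; nia.
by rewrite j1 p1; case: eg => -[e1 g1]; rewrite e1; rewrite g1 in Ej; lia.
Qed.

Lemma arcB_pos (i : nat) : (0 < i <= g * p)%N ->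
  0 < - p%:Z + (n%:Z - - e%:Z) * i%:Z - m%:Z * i%:Z ^+ 2.
Proof.
case/andP=> i0 le_i; pose j := (g * p - i)%N.
have Ej : (g * p = i + j)%N by rewrite /j; lia.
have -> : n%:Z = m%:Z * (i%:Z + j%:Z) by rewrite -PoszD -Ej; lia.
rewrite (_ : _ - _ = i%:Z * (m%:Z * j%:Z + e%:Z) - p%:Z); last by ring.
have [j0|j0] := posnP j.
  by rewrite j0; case: eg => -[e1 g1]; rewrite e1; rewrite g1 in Ej; lia.
(* This is (i - 1)(j - 1) >= 0. With m >= 3 it gives i (m j + e) >= 3 (g p - 1) + i > p. *)
have ij : (i + j <= i * j + 1)%N by nia.
have H1 : (3 * (i * j) + i <= i * (m * j + e))%N.
  rewrite mulnDr leq_add //; last by case: eg => -[-> _]; lia.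
  by rewrite (mulnCA i) leq_mul2r m_gt2 orbT.
have H2 : (p < i * (m * j + e))%N.
  by apply: leq_trans H1; case: eg => -[_ g1]; rewrite g1 in Ej; lia.
by lia.
Qed.

(** The discriminant is that of (p, e - n, m), namely n^2 + e^2 - 2 e n + 4 p m, and e g = 2 cancels
    the last two terms. *)
Lemma simple_arcA (i : nat) : (i < g * m)%N -> simple d%:Z (arcA i).
Proof.
move=> lt_i; rewrite /= arcA_pos // ltz_nat p_gt0 /=; apply/eqP.
rewrite PoszD !(PoszM, expnS) !expn0.
by case: eg => -[-> ->]; ring.
Qed.

Lemma simple_arcB (i : nat) : (0 < i <= g * p)%N -> simple d%:Z (arcB i).
Proof.
move=> lt_i; rewrite /= arcB_pos // ltz_nat (ltn_trans _ m_gt2) //=; apply/eqP.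
rewrite PoszD !(PoszM, expnS) !expn0.
by case: eg => -[-> ->]; ring.
Qed.

(** At index g m - 1 the value at (1, 1) is m > 0, so the first branch of [step] is taken and the
    leading coefficient changes from p to m. *)
Lemma arcA_arcB : step (arcA (g * m).-1) = arcB 1.
Proof.
have gm : ((g * m).-1%:Z = g%:Z * m%:Z - 1) by case: eg => -[_ ->]; lia.
rewrite /arc gm /= ifT; last by case: eg => -[-> ->]; rewrite !PoszM; lia.
by congr (_, _, _); case: eg => -[-> ->]; rewrite !PoszM; ring.
Qed.

(** This closes the half walk up to [swap], and it is why [half_cycle] omits index 0 of the first
    arc. *)
Lemma arcB_last : arcB (g * p) = swap (arcA 0).
Proof. by rewrite /arc /=; congr (_, _, _); case: eg => -[-> ->]; rewrite !PoszM; ring. Qed.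

Lemma mem_half_cycle z : reflect
  ((exists2 i, (0 < i < g * m)%N & z = arcA i) \/ (exists2 i, (0 < i <= g * p)%N & z = arcB i))
  (z \in H).
Proof.
apply: (iffP idP); rewrite mem_cat.
  case/orP=> /mapP[i]; rewrite mem_index_iota => hi ->; [left|right]; by exists i.
case=> -[i hi ->]; apply/orP; [left|right]; apply/mapP; exists i => //;
by rewrite mem_index_iota.
Qed.

Lemma mem_cycle_of z : (z \in C) = (z \in H) || (swap z \in H).
Proof. by rewrite mem_cat -{2}(swapK z) (mem_map (inv_inj swapK)). Qed.

Lemma swap_cycle_of z : (swap z \in C) = (z \in C).
Proof. by rewrite !mem_cycle_of swapK orbC. Qed.

Lemma simple_half_cycle z : z \in H -> simple d%:Z z.
Proof.
by case/mem_half_cycle=> -[i hi ->]; [apply: simple_arcA; case/andP: hi|apply: simple_arcB].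
Qed.

Lemma simple_cycle_of z : z \in C -> simple d%:Z z.
Proof.
rewrite mem_cycle_of => /orP[] /simple_half_cycle //; by rewrite simple_swap.
Qed.

Lemma arcA_in (i : nat) : (0 < i < g * m)%N -> arcA i \in C.
Proof.
by move=> hi; rewrite mem_cycle_of; apply/orP; left; apply/mem_half_cycle; left; exists i.
Qed.

Lemma arcB_in (i : nat) : (0 < i <= g * p)%N -> arcB i \in C.
Proof.
by move=> hi; rewrite mem_cycle_of; apply/orP; left; apply/mem_half_cycle; right; exists i.
Qed.

Lemma gp_gt0 : (0 < g * p)%N. Proof. by rewrite muln_gt0 p_gt0 andbT; case: eg => -[_ ->]. Qed.

Lemma gm_gt1 : (1 < g * m)%N. Proof. by case: eg => -[_ ->]; lia. Qed.

Lemma arcA0_in : arcA 0 \in C.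
Proof. by rewrite -swap_cycle_of -arcB_last arcB_in // gp_gt0 leqnn. Qed.

Lemma step_arcA (i : nat) : (i.+1 < g * m)%N -> step (arcA i) = arcA i.+1.
Proof.
move=> hi; have E : i.+1%:Z = i%:Z + 1 by rewrite intS addrC.
by rewrite E; apply: arc_step; rewrite -E; apply: arcA_pos.
Qed.

Lemma step_arcB (i : nat) : (i.+1 <= g * p)%N -> step (arcB i) = arcB i.+1.
Proof.
move=> hi; have E : i.+1%:Z = i%:Z + 1 by rewrite intS addrC.
by rewrite E; apply: arc_step; rewrite -E; apply: arcB_pos.
Qed.

Hypothesis nsq : forall k : int, k ^+ 2 != d%:Z.

Lemma step_cycle_of z : z \in C -> step z \in C.
Proof.
have stepH x : x \in H -> step x \in C.
  case/mem_half_cycle=> -[i /andP[i0 hi] ->].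
    move: hi; rewrite leq_eqVlt => /orP[/eqP hi|hi].
      by rewrite -[i]/(i.+1.-1) hi arcA_arcB arcB_in // gp_gt0.
    by rewrite step_arcA // arcA_in.
  move: hi; rewrite leq_eqVlt => /orP[/eqP ->|hi]; last by rewrite step_arcB // arcB_in.
  rewrite arcB_last (step_swap nsq); last by apply: simple_arcA; apply: ltnW gm_gt1.
  by rewrite swap_cycle_of step_arcA ?gm_gt1 // arcA_in // gm_gt1.
rewrite mem_cycle_of => /orP[/stepH //|/[dup] zH /stepH].
by rewrite (step_swap nsq) ?swap_cycle_of // -simple_swap; apply: simple_half_cycle.
Qed.

(** * Absence of repetitions and total weight of the walk *)

Lemma uniq_half_cycle : uniq H.
Proof.
rewrite cat_uniq !map_inj_uniq ?iota_uniq /=.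
- rewrite andbT; apply/hasPn => z /mapP[i]; rewrite mem_index_iota => hi ->.
  apply/mapP => -[j]; rewrite mem_index_iota => hj [epm eb _].
  have {}eb : e%:Z = p%:Z * (i%:Z - j%:Z) by move: eb; rewrite epm; lia.
  have : (p %| e)%N by rewrite -[(p %| e)%N]/(p%:Z %| e%:Z)%Z eb dvdz_mulr.
  by move/dvdn_leq; case: eg => -[-> _]; lia.
- move=> i j [eb _]; have {}eb : m%:Z * i%:Z = m%:Z * j%:Z by lia.
  have nz : m%:Z != 0 by lia.
  by have := mulfI nz eb; lia.
- move=> i j [eb _]; have {}eb : p%:Z * i%:Z = p%:Z * j%:Z by lia.
  have nz : p%:Z != 0 by lia.
  by have := mulfI nz eb; lia.
Qed.

(** A swap between the two arcs, or within the second, would make m divide e although 0 < e < m; a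
    swap within the first would give m + p i j = p with i j > 0. *)
Lemma half_cycle_swap z : z \in H -> swap z \notin H.
Proof.
have e_lt : (0 < e < m)%N by case: eg => -[-> _]; lia.
have AB (i j : nat) : (0 < i)%N -> swap (arcA i) <> arcB j.
  move=> i0 [E1 E2 _].
  have F : i%:Z * (m%:Z * j%:Z - e%:Z) = 0.
    have -> : m%:Z * j%:Z = n%:Z - p%:Z * i%:Z by lia.
    by lia.
  move/eqP: F; rewrite mulf_eq0 => /orP[]; first by lia.
  rewrite subr_eq0 -PoszM eqz_nat => /eqP F.
  have : (m %| e)%N by rewrite -F dvdn_mulr.
  by move/dvdn_leq; lia.
move=> zH; apply/negP => szH.
case/mem_half_cycle: zH szH => -[i hi ->] /mem_half_cycle[] [j hj E].
- case: E => E1 E2 E3.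
  have G : p%:Z * (i%:Z + j%:Z) = n%:Z - e%:Z by lia.
  have F : m%:Z + p%:Z * i%:Z * j%:Z = p%:Z.
    by rewrite -[in RHS]E1 (_ : n%:Z - e%:Z = p%:Z * (i%:Z + j%:Z)) //; ring.
  have ij : (0 < i * j)%N by rewrite muln_gt0; case/andP: hi => ->; case/andP: hj => ->.
  by have := leq_pmulr p ij; lia.
- by case: (AB i j); case/andP: hi.
- by case: (AB j i); [case/andP: hj|rewrite -E swapK].
case: E => E1 E2 E3.
have G : e%:Z = m%:Z * (i%:Z + j%:Z - (g * p)%:Z) by rewrite mulrBr -PoszM (mulnC m); lia.
have : (m %| e)%N by rewrite -[(m %| e)%N]/(m%:Z %| e%:Z)%Z G dvdz_mulr.
by move/dvdn_leq; lia.
Qed.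

Lemma uniq_cycle_of : uniq C.
Proof.
rewrite cat_uniq uniq_half_cycle (map_inj_uniq (inv_inj swapK)) uniq_half_cycle andbT /=.
apply/hasPn => _ /mapP[z zH ->]; exact: half_cycle_swap.
Qed.

Definition lead (x : form) : int := x.1.1.

Lemma sum_quadratic (a b c : int) N :
  6 * (\sum_(1 <= i < N.+1) (a + b * i%:Z - c * i%:Z ^+ 2)) =
  6 * a * N%:Z + 3 * b * N%:Z * (N%:Z + 1) - c * N%:Z * (N%:Z + 1) * (2 * N%:Z + 1).
Proof.
elim: N => [|N IH]; first by rewrite big_geq //; ring.
by rewrite big_nat_recr //= mulrDr IH intS; ring.
Qed.

(** The half walk contributes the constants p and m, its swapped image the last coefficients,
    quadratic in the index. With n = g p m the result is 6 times the p-summand, for r = 4 if g = 1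
    and for r = 1 if g = 2. *)
Lemma sum_cycle_of : 6 * (\sum_(x <- C) lead x) =
  (g * p * m)%:Z * (g%:Z ^+ 2 * (p%:Z ^+ 2 + m%:Z ^+ 2) + 10).
Proof.
rewrite big_cat big_map /= !big_cat /= !big_map /lead /=.
have [N EN] : exists N, (g * m = N.+1)%N by exists (g * m).-1; have := gm_gt1; lia.
rewrite EN !sumr_const_nat !mulrDr !sum_quadratic !subn1 /=.
have EN' : N%:Z = g%:Z * m%:Z - 1 by lia.
rewrite -[p%:Z *+ _]mulr_natr -[m%:Z *+ _]mulr_natr !natz EN' !PoszM.
by case: eg => -[-> ->]; ring.
Qed.
End Cycle.

(** * Counting classes and summing over simple forms *)

(** Every form of the walk is reached from index 0 of the first arc by repeated [step] and at most
    one [swap], both of which keep the class. *)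
Lemma cycle_of_equiv (e g p m : nat) (d := ((g * p * m) ^ 2 + e ^ 2)%N) z :
  (e = 2%N /\ g = 1%N) \/ (e = 1%N /\ g = 2%N) -> (0 < p)%N -> (2 < m)%N ->
  squarefree d -> (1 < d)%N -> (d = 1 %[mod 4])%N -> z \in cycle_of e g p m ->
  ideal_equiv (ring_of_integers (quadratic_field d)) (ideal_of d z)
    (ideal_of d (arc e%:Z (g * p * m)%N%:Z p%:Z m%:Z 0)).
Proof.
move=> eg p0 m2 dsf d1 d4; set n := (g * p * m)%N; set x0 := arc _ _ _ _ 0.
pose P z := ideal_equiv (ring_of_integers (quadratic_field d)) (ideal_of d z) (ideal_of d x0).
have Pstep x : simple d%:Z x -> P x -> P (step x).
  by move=> sx; apply: ideal_equiv_trans; apply/ideal_equiv_sym/ideal_of_step.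
have Pswap x : simple d%:Z x -> P x -> P (swap x).
  by move=> sx; apply: ideal_equiv_trans; apply/ideal_equiv_sym/ideal_of_swap.
have PA i : (i < g * m)%N -> P (arc e%:Z n%:Z p%:Z m%:Z i%:Z).
  elim: i => [_|i IH hi]; first exact: ideal_equiv_refl.
  rewrite -(step_arcA eg p0 m2 hi); apply: Pstep; last by apply: IH; apply: ltnW.
  exact: simple_arcA eg p0 m2 _ (ltnW hi).
have gm := gm_gt1 eg p0 m2.
have PB i : (i < g * p)%N -> P (arc (- e%:Z) n%:Z m%:Z (- p%:Z) i.+1%:Z).
  elim: i => [_|i IH hi].
    rewrite -(arcA_arcB eg p0 m2); apply: Pstep; last by apply: PA; lia.
    by apply: (simple_arcA eg p0 m2); lia.
  rewrite -(step_arcB eg p0 m2) //; apply: Pstep; last by apply: IH; apply: ltnW.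
  by apply: (simple_arcB eg p0 m2); lia.
have PH x : x \in half_cycle e g p m -> P x.
  case/mem_half_cycle=> -[i hi ->]; first by apply: PA; case/andP: hi.
  by case: i hi => // i /andP[_ hi]; apply: PB.
rewrite mem_cycle_of => /orP[/PH //|sz]; rewrite -[z]swapK.
exact: Pswap (simple_half_cycle eg p0 m2 sz) (PH _ sz).
Qed.

Section ClassNumber.

Variable d : nat.
Hypothesis d_sqfree : squarefree d.
Hypothesis d_gt1 : (1 < d)%N.
Hypothesis d_mod4 : (d = 1 %[mod 4])%N.

Local Notation O := (ring_of_integers (quadratic_field d)).
Local Notation ideal_of := (ideal_of d).

Lemma eq_ideal_class I J : nonzero_ideal O J ->
  ideal_class O I = ideal_class O J <-> ideal_equiv O I J.
Proof.
move=> nJ; split=> [E|E].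
  have : ideal_class O J J by split=> //; apply: ideal_equiv_refl.
  by rewrite -E => -[].
apply/seteqP; split=> L [nL eL]; split=> //; apply: ideal_equiv_trans eL => //.
exact: ideal_equiv_sym.
Qed.

Definition form_class (x : form) := ideal_class O (ideal_of x).

Lemma ideal_classesE :
  ideal_classes (quadratic_field d) = [set form_class x | x in [set x | simple d%:Z x]].
Proof.
apply/seteqP; split=> k /= [].
  move=> I nI <-; have [x sx ex] := ideal_simple d_sqfree d_gt1 d_mod4 nI.
  by exists x => //; apply/esym/eq_ideal_class => //; apply: ideal_of_ideal.
by move=> x sx <-; exists (ideal_of x) => //; apply: ideal_of_ideal.
Qed.

(** Each set is exactly the set of simple forms of one class: it is closed by [equiv_mem_closed] and
    lies in a single class by assumption. As [x2] is outside [C1], the two classes differ. *)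
Lemma class_number_eq2 (C1 C2 : seq form) (x1 x2 : form) :
  {in C1 ++ C2, forall z, simple d%:Z z} ->
  {in C1, forall z, step z \in C1} -> {in C2, forall z, step z \in C2} ->
  {in C1, forall z, swap z \in C1} -> {in C2, forall z, swap z \in C2} ->
  x1 \in C1 -> x2 \in C2 -> x2 \notin C1 ->
  {in C1, forall z, ideal_equiv O (ideal_of z) (ideal_of x1)} ->
  {in C2, forall z, ideal_equiv O (ideal_of z) (ideal_of x2)} ->
  h d = 2%N <-> (forall x, simple d%:Z x -> x \in C1 ++ C2).
Proof.
move=> sC st1 st2 sw1 sw2 x1C x2C x2n e1 e2.
have sC1 : {in C1, forall z, simple d%:Z z} by move=> z zC; apply: sC; rewrite mem_cat zC.
have sC2 : {in C2, forall z, simple d%:Z z} by move=> z zC; apply: sC; rewrite mem_cat zC orbT.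
have classP x y : simple d%:Z y ->
    form_class x = form_class y <-> ideal_equiv O (ideal_of x) (ideal_of y).
  by move=> sy; apply: eq_ideal_class; apply: ideal_of_ideal.
have ne12 : form_class x1 != form_class x2.
  apply/eqP => /esym /(classP _ _ (sC1 _ x1C)) E; case/negP: x2n.
  exact: (equiv_mem_closed d_sqfree d_gt1 d_mod4 sC1 st1 sw1 (sC2 _ x2C) x1C E).
rewrite /h /class_number ideal_classesE; set A := [set _ | _ in _]; split.
  move=> card2 x sx.
  (* On an infinite set [fset_set] is empty, which would make the cardinality 0 instead of 2. *)
  have finA : finite_set A.
    by apply: contrapT => infA; move: card2; rewrite /fset_set; case: pselect.
  have mem y : simple d%:Z y -> form_class y \in fset_set A.
    by move=> sy; rewrite in_fset_set // inE; exists y.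
  have : ([fset form_class x1; form_class x2] == fset_set A)%fset.
    rewrite eqEfcard cardfs2 ne12 card2 leqnn andbT; apply/fsubsetP => k.
    by rewrite !inE => /orP[] /eqP->; apply: mem; [apply: sC1|apply: sC2].
  move/eqP=> EA; have := mem x sx; rewrite -EA !inE mem_cat => /orP[] /eqP E; apply/orP.
    left; apply: (equiv_mem_closed d_sqfree d_gt1 d_mod4 sC1 st1 sw1 sx x1C).
    exact/(classP _ _ (sC1 _ x1C)).
  right; apply: (equiv_mem_closed d_sqfree d_gt1 d_mod4 sC2 st2 sw2 sx x2C).
  exact/(classP _ _ (sC2 _ x2C)).
move=> all12; have -> : A = [set form_class x1; form_class x2].
  apply/seteqP; split=> k /=; last first.
    by case=> ->; [exists x1|exists x2] => //=; [apply: sC1|apply: sC2].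
  move=> [x /= sx <-]; have := all12 x sx; rewrite mem_cat => /orP[xC|xC]; [left|right].
    by apply/(classP _ _ (sC1 _ x1C)); apply: e1.
  by apply/(classP _ _ (sC2 _ x2C)); apply: e2.
by rewrite fset_setU // !fset_set1 cardfs2 ne12.
Qed.

End ClassNumber.

(** * The divisor sum as a sum over simple forms *)

Definition middle_coefs (d : nat) : seq int :=
  [seq t <- [seq i%:Z - d%:Z | i <- iota 0 (2 * d).+1] |
    (t ^+ 2 < d%:Z) && (t ^+ 2 == d%:Z %[mod 4])%Z].

Definition simple_forms (d : nat) : seq form :=
  [seq (a%:Z, t, (absz ((d%:Z - t ^+ 2) %/ 4)%Z %/ a)%N%:Z) |
    t <- middle_coefs d, a <- divisors (absz ((d%:Z - t ^+ 2) %/ 4)%Z)].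

Lemma mem_middle_coefs d t :
  (t \in middle_coefs d) = (t ^+ 2 < d%:Z) && (t ^+ 2 == d%:Z %[mod 4])%Z.
Proof.
rewrite mem_filter; apply: andb_idr => /andP[lt_td _].
(* Since t^2 < d bounds |t| by d, scanning from - d to d misses nothing; t sits at index t + d. *)
apply/mapP; exists (absz (t + d%:Z)); rewrite ?mem_iota; last by nia.
by rewrite add0n /=; nia.
Qed.

Lemma uniq_middle_coefs d : uniq (middle_coefs d).
Proof. by rewrite filter_uniq // map_inj_uniq ?iota_uniq // => i j; lia. Qed.

Lemma middle_coefs_norm d t : t \in middle_coefs d ->
  let N := absz ((d%:Z - t ^+ 2) %/ 4)%Z in (0 < N)%N /\ t ^+ 2 + 4 * N%:Z = d%:Z.
Proof. by rewrite mem_middle_coefs => /andP[] /=; lia. Qed.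

Lemma mem_simple_forms d x : (x \in simple_forms d) = simple d%:Z x.
Proof.
apply/allpairsPdep/idP => [[t [a [td ad ->]]]|].
  have [N0 E] := middle_coefs_norm td; move: N0 E ad; set N := absz _ => N0 E.
  rewrite -dvdn_divisors // => /dvdnP[c Ec].
  have a0 : (0 < a)%N by move: N0; rewrite Ec muln_gt0 => /andP[].
  rewrite /= Ec mulnK //; apply/and3P; split.
  - by lia.
  - by move: N0; rewrite Ec muln_gt0 => /andP[].
  - by rewrite -E Ec PoszM; apply/eqP; ring.
case: x => [[a b] c] /and3P[a0 c0 /eqP E].
have bd : b \in middle_coefs d.
  rewrite mem_middle_coefs -E; apply/andP; split.
    by rewrite ltrDl !mulr_gt0.
  by apply/eqP; rewrite addrC -mulrA mulrC modzMDl.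
have EN : absz ((d%:Z - b ^+ 2) %/ 4)%Z = (absz a * absz c)%N.
  rewrite -E (_ : _ - _ = a * c * 4); last by ring.
  by rewrite mulzK // abszM.
exists b, (absz a); rewrite EN; split=> //.
  by rewrite -dvdn_divisors ?dvdn_mulr // muln_gt0 !absz_gt0 !gt_eqF.
by rewrite mulKn ?absz_gt0 ?gt_eqF // !gez0_abs ?ltW.
Qed.

Lemma uniq_simple_forms d : uniq (simple_forms d).
Proof.
apply: allpairs_uniq_dep.
- exact: uniq_middle_coefs.
- by move=> t _; apply: divisors_uniq.
by move=> [t a] [t' a'] _ _ /= [-> -> _].
Qed.

Lemma sum_simple_forms d :
  \sum_(x <- simple_forms d) lead x =
  \sum_(t <- middle_coefs d) (sigma (absz ((d%:Z - t ^+ 2) %/ 4)%Z))%:Z.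
Proof.
rewrite big_allpairs_dep; apply: eq_bigr => t _; rewrite /sigma /lead /=.
by rewrite (big_morph Posz PoszD (erefl _)).
Qed.

Lemma sum_sigma_simple_forms d :
  \sum_(t \in [set t : int | `|t%:~R : algC| < sqrtC d%:R
                             /\ (t ^+ 2 = d%:Z %[mod 4])%Z])
     ((sigma `|((d%:Z - t ^+ 2) %/ 4)%Z|%N)%:R : rat) =
  (\sum_(x <- simple_forms d) lead x)%:~R.
Proof.
rewrite sum_simple_forms (_ : [set t | _] = [set` middle_coefs d]); last first.
  have lt_iff (t : int) : (`|t%:~R : algC| < sqrtC d%:R) = (t ^+ 2 < d%:Z).
    have nn : `|t%:~R : algC| \is Num.nneg by exact: normr_ge0.
    have nn' : (sqrtC d%:R : algC) \is Num.nneg by rewrite nnegrE sqrtC_ge0 ler0n.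
    rewrite -(@ltr_pXn2r algC 2) // sqrtCK real_normK ?realz //.
    by rewrite -rmorphXn /= [d%:R]pmulrn ltr_int.
  apply/seteqP; split=> t /=; rewrite mem_middle_coefs lt_iff.
    by case=> -> /eqP.
  by case/andP=> -> /eqP.
rewrite -fsbig_seq ?uniq_middle_coefs // rmorph_sum /=.
by apply: eq_bigr => t _; rewrite -pmulrn.
Qed.

(** Any element of [s2] missing from [s1] would add a strictly positive term. *)
Lemma sub_sum_eq (s1 s2 : seq form) : uniq s1 -> uniq s2 -> {subset s1 <= s2} ->
  {in s2, forall x, 0 < lead x} ->
  {subset s2 <= s1} <-> \sum_(x <- s2) lead x = \sum_(x <- s1) lead x.
Proof.
move=> u1 u2 sub pos.
have P : perm_eq s2 (s1 ++ [seq x <- s2 | x \notin s1]).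
  rewrite -(perm_filterC [in s1] s2) perm_cat2r.
  apply: uniq_perm => //; first by rewrite filter_uniq.
  by move=> x; rewrite mem_filter; case: (boolP (x \in s1)) => // /sub ->.
rewrite (perm_big _ P) big_cat /=; split=> [sub'|E].
  rewrite [X in _ + X]big1_seq ?addr0 // => x; rewrite mem_filter => /and3P[_ xn /sub'].
  by rewrite (negPf xn).
move=> x xs2; apply/negPn/negP => xn; move/eqP: E; rewrite -subr_eq0 addrAC subrr add0r.
rewrite big_filter (big_rem x) //= xn gt_eqF // ltr_wpDr ?pos //.
by rewrite big_seq_cond sumr_ge0 // => y /andP[/mem_rem ys _]; apply/ltW/pos.
Qed.

(** * The two walks against all simple forms *)

Lemma arc0_notin_principal (e g p m : nat) : (1 < p)%N -> (1 < m)%N ->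
  arc e%:Z (g * p * m)%N%:Z p%:Z m%:Z 0 \notin cycle_of e g 1 (p * m).
Proof.
move=> p1 m1; have [pm pm'] : (p < p * m)%N /\ (m < p * m)%N.
  by rewrite ltn_Pmulr ?ltn_Pmull //; lia.
(* Every form of the principal walk has 1 or p m as leading or last coefficient, whereas here these
   are p and m, strictly between. *)
rewrite mem_cycle_of negb_or; apply/andP; split; apply/negP => /mem_half_cycle[] [i _].
all: by case=> *; lia.
Qed.

Lemma class_number_eq2_sum (e g p m : nat) (d := ((g * p * m) ^ 2 + e ^ 2)%N) :
  (e = 2%N /\ g = 1%N) \/ (e = 1%N /\ g = 2%N) -> (2 < p)%N -> (2 < m)%N ->
  squarefree d -> (1 < d)%N -> (d = 1 %[mod 4])%N ->
  h d = 2%N <->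
  6 * (\sum_(x <- simple_forms d) lead x) =
  (g * p * m)%:Z * (g%:Z ^+ 2 * (1 + (p * m)%:Z ^+ 2) + 10) +
  (g * p * m)%:Z * (g%:Z ^+ 2 * (p%:Z ^+ 2 + m%:Z ^+ 2) + 10).
Proof.
move=> eg p2 m2 dsf d1 d4.
have p0 : (0 < p)%N by lia.
have pm2 : (2 < p * m)%N by apply: leq_trans p2 _; rewrite leq_pmulr //; lia.
have En : (g * 1 * (p * m) = g * p * m)%N by rewrite muln1 mulnA.
have Ed : ((g * 1 * (p * m)) ^ 2 + e ^ 2 = d)%N by rewrite En.
have nsq := squarefree_not_square dsf d1.
set C1 := cycle_of e g 1 (p * m); set C2 := cycle_of e g p m.
set x1 := arc e%:Z (g * p * m)%N%:Z 1 (p * m)%N%:Z 0.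
set x2 := arc e%:Z (g * p * m)%N%:Z p%:Z m%:Z 0.
have sC1 : {in C1, forall z, simple d%:Z z}.
  by move=> z zC; rewrite -Ed; apply: simple_cycle_of zC.
have sC2 : {in C2, forall z, simple d%:Z z} by move=> z; apply: simple_cycle_of.
have sC : {in C1 ++ C2, forall z, simple d%:Z z}.
  by move=> z; rewrite mem_cat => /orP[/sC1|/sC2].
have st1 : {in C1, forall z, step z \in C1}.
  by move=> z; apply: step_cycle_of => //; rewrite Ed.
have st2 : {in C2, forall z, step z \in C2} by move=> z; apply: step_cycle_of.
have sw1 : {in C1, forall z, swap z \in C1} by move=> z; rewrite swap_cycle_of.
have sw2 : {in C2, forall z, swap z \in C2} by move=> z; rewrite swap_cycle_of.
have x1C : x1 \in C1 by have := arcA0_in (p * m) eg (ltn0Sn 0); rewrite En.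
have x2C : x2 \in C2 by apply: arcA0_in.
have x2n : x2 \notin C1 by apply: arc0_notin_principal; lia.
have e1 : {in C1, forall z, ideal_equiv (ring_of_integers (quadratic_field d))
    (ideal_of d z) (ideal_of d x1)}.
  move=> z zC; have := @cycle_of_equiv e g 1 (p * m) z eg (ltn0Sn 0) pm2.
  by rewrite Ed En; apply.
have e2 : {in C2, forall z, ideal_equiv (ring_of_integers (quadratic_field d))
    (ideal_of d z) (ideal_of d x2)} by move=> z zC; apply: cycle_of_equiv.
(* A common form would be equivalent to [x2], which would force [x2] into [C1]. *)
have disj z : z \in C1 -> z \notin C2.
  move=> zC1; apply/negP => zC2; case/negP: x2n.
  apply: (equiv_mem_closed dsf d1 d4 sC1 st1 sw1 (sC2 _ x2C) zC1).
  exact/ideal_equiv_sym/e2.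
have uC : uniq (C1 ++ C2).
  rewrite cat_uniq !uniq_cycle_of // andbT; apply/hasPn => z zC2.
  by apply/negP => /disj; rewrite zC2.
have subC : {subset C1 ++ C2 <= simple_forms d}.
  by move=> z /sC; rewrite mem_simple_forms.
have pos : {in simple_forms d, forall z, 0 < lead z}.
  by move=> [[a b] c]; rewrite mem_simple_forms => /and3P[].
have S1 := sum_cycle_of eg (ltn0Sn 0) pm2; have S2 := sum_cycle_of eg p0 m2.
have key := class_number_eq2 dsf d1 d4 sC st1 st2 sw1 sw2 x1C x2C x2n e1 e2.
have sums := sub_sum_eq uC (uniq_simple_forms d) subC pos.
have <- : 6 * \sum_(x <- C1 ++ C2) lead x =
  (g * p * m)%:Z * (g%:Z ^+ 2 * (1 + (p * m)%:Z ^+ 2) + 10) +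
  (g * p * m)%:Z * (g%:Z ^+ 2 * (p%:Z ^+ 2 + m%:Z ^+ 2) + 10).
  by rewrite big_cat /= mulrDr S1 S2 En expr1n.
apply: (iff_trans key); split=> [all|E].
  by congr (6 * _); apply/sums => z; rewrite mem_simple_forms; apply: all.
by move=> x; rewrite -mem_simple_forms; move: x; apply/sums; apply: (@mulfI _ 6).
Qed.

(** Squares modulo 8 force n to be odd if r = 4 and n to be 2 modulo 4 if r = 1; g is the power of 2
    split off, and e is the square root of r. *)
Lemma sqr_add_mod8 (r n : nat) : r = 1%N \/ r = 4%N -> (n ^ 2 + r = 5 %[mod 8])%N ->
  exists e g k : nat, [/\ (e = 2%N /\ g = 1%N) \/ (e = 1%N /\ g = 2%N),
    r = (e ^ 2)%N, n = (g * k)%N & odd k].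
Proof.
move=> hr; have En := divn_eq n 4; have lt4 : (n %% 4 < 4)%N by rewrite ltn_mod.
move: En lt4; set q := (n %/ 4)%N; set s := (n %% 4)%N => -> lt4.
have -> : ((q * 4 + s) ^ 2 = 16 * (q * q) + 8 * (q * s) + s * s)%N by ring.
case: hr => ->; case: s lt4 => [|[|[|[|]]]] // _ H; try by exfalso; lia.
- by exists 1%N, 2%N, (2 * q + 1)%N; split; [right|..]; rewrite // ?oddD ?oddM //; lia.
- by exists 2%N, 1%N, (q * 4 + 1)%N; split; [left|..]; rewrite // ?oddD ?oddM ?andbF //; lia.
by exists 2%N, 1%N, (q * 4 + 3)%N; split; [left|..]; rewrite // ?oddD ?oddM ?andbF //; lia.
Qed.

Theorem theorem4p3 (r n d p : nat)
  (hr : r = 1%N \/ r = 4%N)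
  (hn : (0 < n)%N)
  (hd : d = (n ^ 2 + r)%N)
  (d_sqfree : squarefree d)
  (d_mod8 : (d = 5 %[mod 8])%N)
  (p_prime : prime p)
  (p_odd : odd p)
  (p_dvd_n : (p %| n)%N)
  (h4 : r = 4%N -> n <> p)
  (h1 : r = 1%N -> n <> (2 * p)%N) :
  h d = 2%N <->
  \sum_(t \in [set t : int | `|t%:~R : algC| < sqrtC d%:R
                             /\ (t ^+ 2 = d%:Z %[mod 4])%Z])
     ((sigma `|((d%:Z - t ^+ 2) %/ 4)%Z|%N)%:R : rat)
  = (if r == 4%N then
       (n%:R ^+ 3 + 11 * n%:R) / 6
       + (n%:R ^+ 3 + n%:R * (p%:R ^+ 4 + 10 * p%:R ^+ 2)) / (6 * p%:R ^+ 2)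
     else
       (n%:R ^+ 3 + 14 * n%:R) / 6
       + (n%:R ^+ 3 + n%:R * (4 * p%:R ^+ 4 + 10 * p%:R ^+ 2))
         / (6 * p%:R ^+ 2)).
Proof.
rewrite sum_sigma_simple_forms.
have d_mod4 : (d = 1 %[mod 4])%N by lia.
have [e [g [k [eg Er En k_odd]]]] : exists e g k : nat,
    [/\ (e = 2%N /\ g = 1%N) \/ (e = 1%N /\ g = 2%N), r = (e ^ 2)%N, n = (g * k)%N & odd k].
  by apply: sqr_add_mod8; rewrite -?hd.
have p_gt1 := prime_gt1 p_prime.
have p2 : (2 < p)%N by case: p p_gt1 p_odd {p_prime p_dvd_n h4 h1} => [|[|[|]]].
have : (p %| k)%N.
  move: p_dvd_n; rewrite En; case: eg => -[_ ->]; first by rewrite mul1n.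
  by rewrite Gauss_dvdr // coprimen2.
case/dvdnP=> m; rewrite mulnC => Ek.
have {}En : n = (g * p * m)%N by rewrite En Ek mulnA.
(* As a factor of the odd k, m is odd, and m = 1 would mean n = p for r = 4 or n = 2 p for r = 1. *)
have m2 : (2 < m)%N.
  move: k_odd; rewrite Ek oddM => /andP[_].
  case: m Ek En => [|[|[|m]]] // Ek En _; exfalso.
  by case: eg => -[e1 g1]; rewrite e1 in Er; [apply: (h4 Er)|apply: (h1 Er)]; rewrite En g1; lia.
have Ed : d = ((g * p * m) ^ 2 + e ^ 2)%N by rewrite hd Er En.
have d1 : (1 < d)%N by case: (d) d_mod8 => [|[|]].
rewrite Ed in d_sqfree d_mod4 d1 *.
apply: (iff_trans (class_number_eq2_sum eg p2 m2 d_sqfree d1 d_mod4)).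
set S := \sum_(x <- _) _; rewrite [in X in _ <-> X]En.
have p0 : p%:R != 0 :> rat by rewrite pnatr_eq0; lia.
(* Transfers the integral equation, cleared of the factor 1/6, to the rational one. *)
have scale (V : int) (W : rat) : V%:~R = 6 * W -> 6 * S = V <-> S%:~R = W.
  move=> EV; split=> [E|E].
    by apply: (@mulfI _ 6) => //; rewrite -EV -E intrM.
  by apply: (@intr_inj rat); rewrite EV -E intrM.
apply: scale; rewrite Er.
by case: eg => -[-> ->] /=; rewrite !(intrD, intrM, rmorphXn) /= -!pmulrn !natrM; field.
Qed.
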